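(* The dual operad of the left-Novikov operad is the right-Novikov operad, and the dual operad of the right-Novikov operad is the left-Novikov operad. The Novikov operad is not Koszul (that is, neither the left-Novikov operad nor the right-Novikov operad is Koszul).
   Context: An algebra $(A,\circ)$ is a vector space $A$ over the base field $K$ with a bilinear multiplication $\circ$ (no associativity or unit is assumed). Its associator is $(a,b,c)=a\circ(b\circ c)-(a\circ b)\circ c$. The algebra is called right-symmetric if $(a,b,c)=(a,c,b)$ for all $a,b,c\in A$, and left-symmetric if $(a,b,c)=(b,a,c)$ for all $a,b,c\in A$. It is called left-commutative if $a\circ(b\circ c)=b\circ(a\circ c)$ for all $a,b,c\in A$, and right-commutative if $(a\circ b)\circ c=(a\circ c)\circ b$ for all $a,b,c\in A$. A left-Novikov algebra is an algebra that is right-commutative and left-symmetric. A right-Novikov algebra is an algebra that is left-commutative and right-symmetric; equivalently, it satisfies $a\circ(b\circ c-c\circ b)=(a\circ b)\circ c-(a\circ c)\circ b$ and $a\circ(b\circ c)=b\circ(a\circ c)$. Passing to the opposite multiplication $a\star b=b\circ a$ interchanges left- and right-Novikov algebras, so ''Novikov operad'' may refer to either operad. The left-Novikov (right-Novikov) operad is the operad governing left-Novikov (right-Novikov) algebras. Both are binary quadratic operads: each is of the form $\mathcal{P}=\mathcal{F}(E)/(R)$, where $\mathcal{F}(E)$ is the free symmetric operad generated by $E=K[S_2]$ in arity $2$ (one binary operation with no symmetry), and $R\subset\mathcal{F}(E)(3)$ is the $S_3$-submodule generated by the defining identities. The dual operad is the quadratic dual in the sense of Ginzburg and Kapranov, $\mathcal{P}^{!}=\mathcal{F}(E^{\vee})/(R^{\perp})$,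 where $E^{\vee}=E^{*}\otimes\mathrm{sgn}_2$ and $R^{\perp}$ is the annihilator of $R$ under the natural identification $\mathcal{F}(E^{\vee})(3)\cong \mathcal{F}(E)(3)^{*}\otimes\mathrm{sgn}_3$. ''Koszul'' is meant in the usual sense of Ginzburg and Kapranov for quadratic operads. *)

(* Defs.v *)
From HB Require Import structures.
From mathcomp Require Import all_boot all_order all_algebra all_fingroup.
From mathcomp Require Import finmap.
From mathcomp.multinomials Require Import monalg.

Set Implicit Arguments.
Unset Strict Implicit.
Unset Printing Implicit Defensive.

Import GRing.Theory.
Local Open Scope ring_scope.

(* Operads are presented in their finite-set form: P(A) is the space of
   operations whose inputs are labelled bijectively by the finite set A, with
   relabellings P(A) -> P(B) and partial compositions
   P(A) (x) P(B) -> P((A - a) + B).  The component P(n) is P({0, ..., n-1})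
   with S_n acting by relabelling. *)

Inductive term (E V : Type) :=
  | Var of V
  | Op of E & term E V & term E V.
Arguments Var {E V}.
Arguments Op {E V}.

Section TermChoice.
Context {E V : choiceType}.

Fixpoint term_code (t : term E V) : GenTree.tree (E + V) :=
  match t with
  | Var i => GenTree.Leaf (inr i)
  | Op e l r => GenTree.Node 0 [:: GenTree.Leaf (inl e); term_code l; term_code r]
  end.

Fixpoint term_decode (c : GenTree.tree (E + V)) : option (term E V) :=
  match c with
  | GenTree.Leaf (inr i) => Some (Var i)
  | GenTree.Node _ [:: GenTree.Leaf (inl e); cl; cr] =>
      if (term_decode cl, term_decode cr) is (Some l, Some r)
      then Some (Op e l r) else None
  | _ => None
  end.

Lemma term_codeK : pcancel term_code term_decode.
Proof. by elim=> //= e l -> r ->. Qed.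

HB.instance Definition _ := Choice.copy (term E V) (pcan_type term_codeK).

End TermChoice.

(* A K[S_2]-module: flip is the action of the transposition. *)
Record s2module (K : fieldType) := S2Module {
  s2space :> vectType K;
  flip : {linear s2space -> s2space};
  flipK : involutive flip
}.

Arguments flip {K s}.

Section Operads.
Context {K : fieldType}.

Fixpoint leaves (E V : Type) (t : term E V) : seq V :=
  match t with
  | Var i => [:: i]
  | Op _ l r => leaves l ++ leaves r
  end.

(* Formal linear combinations of E-decorated trees.  They are not yet linear in
   the decorations: F(E) is obtained from them by imposing [ideal_lin] and
   [ideal_flip] below. *)
Notation pre E V := {malg K[term (s2space E) V]}.

Definition xvar (E : s2module K) (V : choiceType) (i : V) : pre E V := << Var i >>.

Definition op (E : s2module K) (V : choiceType) (e : E) (p q : pre E V) : pre E V :=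
  \sum_(s <- msupp p) \sum_(t <- msupp q) (p@_s * q@_t) *: << Op e s t >>.

Fixpoint tsubst (E : s2module K) (V W : choiceType) (f : V -> pre E W)
    (t : term E V) : pre E W :=
  match t with
  | Var i => f i
  | Op e l r => op e (tsubst f l) (tsubst f r)
  end.

Definition subst (E : s2module K) (V W : choiceType) (f : V -> pre E W)
    (p : pre E V) : pre E W :=
  \sum_(t <- msupp p) p@_t *: tsubst f t.

Definition relabel (E : s2module K) (V W : choiceType) (f : V -> W)
    (p : pre E V) : pre E W :=
  subst (fun i => xvar E (f i)) p.

Definition pcomp (E : s2module K) (V : choiceType) (a : V) (p q : pre E V) : pre E V :=
  subst (fun i => if i == a then q else xvar E i) p.

(* For duplicate-free A: p only involves trees whose leaves are labelled
   bijectively by A. *)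
Definition arity (E : s2module K) (V : choiceType) (A : seq V) (p : pre E V) : Prop :=
  forall t, t \in msupp p -> perm_eq (leaves t) A.

Inductive S3_span (E : s2module K) (G : pre E 'I_3 -> Prop) : pre E 'I_3 -> Prop :=
  | S3_gen g of G g : S3_span G g
  | S3_zero : S3_span G 0
  | S3_lin a p q of S3_span G p & S3_span G q : S3_span G (a *: p + q)
  | S3_act (s : 'S_3) p of S3_span G p : S3_span G (relabel s p).

(* The presentation of F(E)/(R), R being the S_3-submodule of F(E)(3) generated
   by the representatives [relators]. *)
Record quadratic := Quadratic {
  gen : s2module K;
  relators : pre gen 'I_3 -> Prop;
  relators_arity : forall r, relators r -> arity (enum 'I_3) r
}.

Definition relations (Q : quadratic) : pre (gen Q) 'I_3 -> Prop :=
  S3_span (@relators Q).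

(* The kernel of pre E V -> F(E)/(R).  Terms with repeated variables do occur
   here, but every generator is homogeneous for the multiset of leaves, so the
   elements of arity A are exactly those of the operadic ideal. *)
Inductive ideal (Q : quadratic) (V : choiceType) : pre (gen Q) V -> Prop :=
  | ideal0 : ideal 0
  | idealD p q of ideal p & ideal q : ideal (p + q)
  | idealZ a p of ideal p : ideal (a *: p)
  | ideal_lin a (e f : gen Q) s t :
      ideal (<< Op (a *: e + f) s t >> - (a *: << Op e s t >> + << Op f s t >>))
  | ideal_flip (e : gen Q) s t : ideal (<< Op e s t >> - << Op (flip e) t s >>)
  | ideal_rel r (f : 'I_3 -> term (gen Q) V) of relations r :
      ideal (subst (fun i => << f i >>) r)
  | ideal_opl (e : gen Q) p q of ideal p : ideal (op e p q)
  | ideal_opr (e : gen Q) p q of ideal q : ideal (op e p q).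

Definition eqmod (Q : quadratic) (V : choiceType) (p q : pre (gen Q) V) : Prop :=
  ideal (p - q).

(* phi induces an isomorphism of operads F(E)/(R) -> F(E')/(R'). *)
Record operad_iso (P Q : quadratic)
    (phi : {linear pre (gen P) nat -> pre (gen Q) nat}) : Prop := OperadIso {
  iso_arity : forall (A : seq nat) p, uniq A -> arity A p -> arity A (phi p);
  iso_inj : forall (A : seq nat) p, uniq A -> arity A p -> ideal p <-> ideal (phi p);
  iso_surj : forall (A : seq nat) q, uniq A -> arity A q ->
    exists2 p, arity A p & eqmod (phi p) q;
  iso_unit : forall i : nat, eqmod (phi (xvar (gen P) i)) (xvar (gen Q) i);
  iso_relabel : forall (A : seq nat) (f : nat -> nat) p,
    uniq A -> {in A &, injective f} -> arity A p ->
    eqmod (phi (relabel f p)) (relabel f (phi p));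
  iso_comp : forall (A B : seq nat) (a : nat) p q,
    uniq A -> uniq B -> a \in A -> ~~ has (mem B) (rem a A) ->
    arity A p -> arity B q ->
    eqmod (phi (pcomp a p q)) (pcomp a (phi p) (phi q))
}.

(* There is an isomorphism of operads P -> Q sending the operation e in P(2) to f. *)
Definition isomorphic_along (P Q : quadratic) (e : gen P) (f : gen Q) : Prop :=
  exists phi : {linear pre (gen P) nat -> pre (gen Q) nat},
    operad_iso phi /\
    eqmod (phi << Op e (Var 0%N) (Var 1%N) >>) << Op f (Var 0%N) (Var 1%N) >>.

Section Dual.
Variable E : s2module K.

Definition dual_flip (f : 'Hom(E, K^o)) : 'Hom(E, K^o) :=
  (- (f \o linfun (@flip K E)))%VF.

Fact dual_flip_is_linear : linear dual_flip.
Proof.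
by move=> a f g; rewrite /dual_flip comp_lfunDl -comp_lfunZl opprD scalerN.
Qed.
HB.instance Definition _ :=
  GRing.isLinear.Build K 'Hom(E, K^o) 'Hom(E, K^o) *:%R dual_flip
    dual_flip_is_linear.

Fact dual_flipK : involutive dual_flip.
Proof.
move=> f; apply/lfunP=> x.
by rewrite /dual_flip !(opp_lfunE, comp_lfunE) !lfunE /= flipK opprK.
Qed.

(* E^v = E^* (x) sgn_2. *)
Definition s2dual : s2module K := @S2Module K 'Hom(E, K^o) dual_flip dual_flipK.

End Dual.

(* An arity 3 tree, rewritten modulo [ideal_flip] as e(e'(a, b), c). *)
Definition left_comb (E : s2module K) (t : term E 'I_3) :
    option (E * E * ('I_3 * 'I_3 * 'I_3)) :=
  match t with
  | Op e (Op e' (Var a) (Var b)) (Var c) => Some (e, e', (a, b, c))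
  | Op e (Var c) (Op e' (Var a) (Var b)) => Some (flip e, e', (a, b, c))
  | _ => None
  end.

Definition sgn3 (a b c : 'I_3) : K := (-1) ^+ ((b < a) + (c < a) + (c < b))%N.

Definition tree_pairing (E : s2module K) (u : term (s2dual E) 'I_3)
    (t : term E 'I_3) : K :=
  match left_comb u, left_comb t with
  | Some (f, f', (a, b, c)), Some (e, e', (a', b', c')) =>
      if (a', b', c') == (a, b, c) then
        sgn3 a b c * ((f : 'Hom(E, K^o)) e * (f' : 'Hom(E, K^o)) e')
      else if (a', b', c') == (b, a, c) then
        sgn3 a b c * ((f : 'Hom(E, K^o)) e * (f' : 'Hom(E, K^o)) (flip e'))
      else 0
  | _, _ => 0
  end.

(* The identification F(E^v)(3) = F(E)(3)^* (x) sgn_3.  F(E)(3) is the sum, over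
   the choice of the leaf c attached to the root, of copies of E (x) E, and
   sgn_3-equivariance determines the pairing from the evaluation of
   E^v (x) E^v on E (x) E at a single c. *)
Definition pairing (E : s2module K) (q : pre (s2dual E) 'I_3) (p : pre E 'I_3) : K :=
  \sum_(u <- msupp q) \sum_(t <- msupp p) q@_u * p@_t * tree_pairing u t.

Definition annihilator (Q : quadratic) (q : pre (s2dual (gen Q)) 'I_3) : Prop :=
  arity (enum 'I_3) q /\ forall r, relations r -> pairing q r = 0.

Fact annihilator_arity (Q : quadratic) q :
  @annihilator Q q -> arity (enum 'I_3) q.
Proof. by case. Qed.

(* P^! = F(E^v)/(R^perp). *)
Definition quadratic_dual (Q : quadratic) : quadratic :=
  @Quadratic (s2dual (gen Q)) (@annihilator Q) (@annihilator_arity Q).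

Section Koszul.
Variables (Q : quadratic) (n : nat).
Notation cluster := {set 'I_n}.

(* A reduced tree with leaves 'I_n is encoded by the laminar family of the leaf
   sets of its vertices: setT is the root vertex, and C != setT stands for the
   internal edge going down from the vertex C. *)
Definition is_tree (F : {set cluster}) : Prop :=
  [/\ [set: 'I_n] \in F,
      forall C, C \in F -> (1 < #|C|)%N &
      forall C D, C \in F -> D \in F ->
        [\/ C \subset D, D \subset C | [disjoint C & D]]].

Definition is_min (C : cluster) (i : 'I_n) : bool :=
  (i \in C) && [forall j in C, (i <= j)%N].

(* The inputs of the vertex C, each named by the least leaf above it. *)
Definition inputs (F : {set cluster}) (C : cluster) : {set 'I_n} :=
  [set i in C | [forall D in F, (D \proper C) && (i \in D) ==> is_min D i]].

(* Decorations of the tree F: families in the product over the vertices C of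
   P(inputs of C), of which P(F) is the tensor product. *)
Definition decorates (F : {set cluster}) (d : cluster -> pre (gen Q) 'I_n) : Prop :=
  forall C, C \in F -> arity (enum (inputs F C)) (d C).

Definition is_parent (F : {set cluster}) (C D : cluster) : bool :=
  [&& D \in F, C \proper D &
      [forall D' in F, (C \proper D') ==> (D \subset D')]].

(* Contraction of the edge C: compose the decoration of C into that of its
   parent. *)
Definition contract (F : {set cluster}) (C : cluster)
    (d : cluster -> pre (gen Q) 'I_n) (D : cluster) : pre (gen Q) 'I_n :=
  if is_parent F C D
  then subst (fun i => if is_min C i then d C else xvar (gen Q) i) (d D)
  else d D.

Definition family := {set cluster} -> (cluster -> pre (gen Q) 'I_n) -> K.

(* phi is an element of the sum, over trees F with m vertices, of P(F)^*, viewed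
   as a space of multilinear forms on decorations that factor through the
   quotient by the ideal. *)
Definition cochain (m : nat) (phi : family) : Prop :=
  forall F, is_tree F -> #|F| = m ->
    (forall C a d d1 d2, C \in F ->
       decorates F d -> decorates F d1 -> decorates F d2 ->
       d C = a *: d1 C + d2 C ->
       (forall D, D \in F -> D != C -> d1 D = d D /\ d2 D = d D) ->
       phi F d = a * phi F d1 + phi F d2) /\
    (forall C d, C \in F -> decorates F d -> ideal (d C) -> phi F d = 0).

Definition eq_cochain (m : nat) (phi psi : family) : Prop :=
  forall F d, is_tree F -> #|F| = m -> decorates F d -> phi F d = psi F d.

(* The rank of the edge C among the internal edges of F, for a fixed total order
   on clusters; this trivializes the factor det(F), the top exterior power of
   the space spanned by the internal edges. *)
Definition edge_rank (F : {set cluster}) (C : cluster) : nat :=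
  #|[set D in F | (D != [set: 'I_n]) && (enum_rank D < enum_rank C)%N]|.

Definition differential (phi : family) : family := fun F d =>
  \sum_(C in F | C != [set: 'I_n])
    (-1) ^+ edge_rank F C * phi (F :\ C) (contract F C d).

Definition exact_at (m : nat) : Prop :=
  forall phi, cochain m phi ->
    eq_cochain m.+1 (differential phi) (fun _ _ => 0) ->
    exists2 psi, cochain m.-1 psi & eq_cochain m (differential psi) phi.

End Koszul.

(* Ginzburg-Kapranov: each complex D(P)(n), that is
     P(n)^* -> (+)_(2 vertices) P(F)^* (x) det(F) -> ... -> (+)_(n-1 vertices),
   is exact everywhere but at its right end, the sum over binary trees.  (Their
   degree shift and their twist by sgn_n do not affect exactness; no tree has 0
   vertices, so exactness at m = 1 is injectivity.) *)
Definition koszul (Q : quadratic) : Prop :=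
  forall n m : nat, (m.+1 < n)%N -> exact_at Q n m.

End Operads.

Section Novikov.
Variable K : fieldType.

Definition swap (v : K^o * K^o) : K^o * K^o := (v.2, v.1).

Fact swap_is_linear : linear swap.
Proof. by []. Qed.
HB.instance Definition _ :=
  GRing.isLinear.Build K (K^o * K^o)%type (K^o * K^o)%type *:%R swap
    swap_is_linear.

Fact swapK : involutive swap.
Proof. by case. Qed.

(* K[S_2]: (u, v) stands for the operation u (a o b) + v (b o a). *)
Definition regular : s2module K := @S2Module K (K^o * K^o)%type swap swapK.

Definition mu : regular := (1, 0).

(* The element dual to mu in the basis (mu, flip mu); it generates the free
   K[S_2]-module E^v. *)
Definition mu_dual : s2dual regular := linfun (fst : K^o * K^o -> K^o).

Notation "s 'o' t" := (Op (mu : s2space regular) s t) (at level 40).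
Notation a := (Var (@Ordinal 3 0 isT) : term regular 'I_3).
Notation b := (Var (@Ordinal 3 1 isT) : term regular 'I_3).
Notation c := (Var (@Ordinal 3 2 isT) : term regular 'I_3).

Definition associator (x y z : term regular 'I_3) : {malg K[term regular 'I_3]} :=
  << x o (y o z) >> - << (x o y) o z >>.

Definition left_novikov_relators (r : {malg K[term regular 'I_3]}) : Prop :=
  r = << (a o b) o c >> - << (a o c) o b >> \/
  r = associator a b c - associator b a c.

Definition right_novikov_relators (r : {malg K[term regular 'I_3]}) : Prop :=
  r = << a o (b o c) >> - << b o (a o c) >> \/
  r = associator a b c - associator a c b.

Fact arityB (V : choiceType) (A : seq V) (p q : {malg K[term regular V]}) :
  arity A p -> arity A q -> arity A (p - q).
Proof.
move=> hp hq t /(fsubsetP (msuppB_le _ _)); rewrite in_fsetU.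
by case/orP; [apply: hp | apply: hq].
Qed.

Fact arityU (t : term regular 'I_3) :
  all (fun i : nat => i \in [seq val j | j <- leaves t]) (iota 0 3) ->
  uniq (leaves t) -> arity (enum 'I_3) (<< t >> : {malg K[term regular 'I_3]}).
Proof.
move=> /allP ht ut u; rewrite msuppU oner_eq0 inE => /eqP ->.
apply: uniq_perm; rewrite ?enum_uniq // => i; rewrite mem_enum.
have hi : val i \in iota 0 3 by rewrite mem_iota ltn_ord.
by have /mapP [j hj /val_inj ->] := ht _ hi; rewrite hj.
Qed.

Fact left_novikov_arity r :
  left_novikov_relators r -> arity (enum 'I_3) r.
Proof. by case=> ->; do !apply: arityB; apply: arityU. Qed.

Fact right_novikov_arity r :
  right_novikov_relators r -> arity (enum 'I_3) r.
Proof. by case=> ->; do !apply: arityB; apply: arityU. Qed.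

Definition left_novikov : @quadratic K := Quadratic left_novikov_arity.
Definition right_novikov : @quadratic K := Quadratic right_novikov_arity.

End Novikov.

(* Main.v *)
From HB Require Import structures.
From mathcomp Require Import all_boot all_algebra all_fingroup.
From mathcomp Require Import finmap.
From mathcomp.multinomials Require Import monalg.
From mathcomp Require Import ring.
Require Import Defs.

Set Implicit Arguments.
Unset Strict Implicit.
Unset Printing Implicit Defensive.

Import GRing.Theory.
Local Open Scope ring_scope.

(** Duality.  The space of operations E has the basis mu, flip mu, and
[f |-> (f (1, 0), - f (0, 1))] is an isomorphism of S_2-modules from E^v onto E
sending the dual generator to mu; the sign comes from the twist by sgn_2.
Transported along it, the pairing in arity three is diagonal in the twelve
monomials: (ab)c is orthogonal to every other monomial and pairs with itself to
the signature, a(bc) pairs with itself to minus the signature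
([bracket_ll] to [bracket_rr]).  Hence the relators of each Novikov operad
annihilate those of the other one.  Conversely an element orthogonal to the
relators of one operad is determined by its twelve coordinates, the
orthogonality conditions leave half of them free, and what remains is an
explicit combination of relators of the other operad ([coordinates_right],
[coordinates_left]).

Failure of Koszulness.  Let m be mu in the left-Novikov case and flip mu in the
right-Novikov case, so that a.b = m(a, b) is right-commutative and
left-symmetric in both.  The complex D(P)(5) is not exact at the trees with
three vertices: there is a cocycle phi there which is not a coboundary, and
this is detected by pairing phi with a cycle.

The cycle comes from the associator T(a, b, c) = a.(b.c) - (a.b).c.
Right-commutativity and left-symmetry together let right multiplications move
freely between its first two arguments and out of it,

    T(a.d, b, c) = T(a, b.d, c) = T(a, b, c).d.

Number the leaves from 0 to 4 and denote a tree by the leaf sets of the vertices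
other than its root.  Consider the five trees with
three vertices

    {03, 14}, {03, 0123}, {13, 0123}, {13, 134}, {14, 134},

each decorated by T(0, 1, 2) and two products.  Contracting either edge of one of
them gives a decorated tree with two vertices, and by right-commutativity and the
identities above each of these trees with two vertices occurs twice: the five trees are
the edges of a pentagon whose vertices are 03, 0123, 13, 134 and 14
([cycle_03] to [cycle_134]).  So on a coboundary the alternating sum of the five
values vanishes.

The cocycle is explicit.  Novikov operations are read in differential
polynomials, where a.b = a b'; the coefficients of x_i x_j', x_i x_j' x_k' and
x_i x_j x_k'' in this reading are linear forms on P(2) and P(3), and phi is a sum
of products of such forms, one per vertex ([table]).  Closedness is a finite
identity between products of forms on P(2), one for each of the 105 binary trees
with five leaves, checked by computation ([check_trees], [cocycle_phi]).  On the
pentagon phi vanishes at four of the five trees and takes the value 1 at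
{13, 0123} ([Phi_13_0123_value]), so it is not a coboundary ([not_exact_5_3]).
All coefficients are 0, 1 or -1, and the argument holds over every field. *)

(** * Linear combinations of trees and substitution *)

Section LinearExtension.
Variables (K : fieldType) (T : choiceType) (N : lmodType K).
Implicit Types (p q : {malg K[T]}) (f : T -> N).

Definition linext f p : N := \sum_(t <- msupp p) p@_t *: f t.

Lemma linextEw f (D : {fset T}) p :
  (msupp p `<=` D)%fset -> linext f p = \sum_(t <- D) p@_t *: f t.
Proof.
move=> sub; rewrite [RHS](big_fsetID _ (mem (msupp p))) /=.
rewrite [X in _ + X]big1_fset ?addr0 => [|t]; last first.
  by rewrite !inE /= => /andP[_ /mcoeff_outdom ->] _; rewrite scale0r.
apply: eq_fbigl => t; rewrite !inE /=.
by apply/idP/andP=> [tp|[]//]; split=> //; apply: (fsubsetP sub).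
Qed.

Lemma linext_is_linear f : linear (linext f).
Proof.
move=> a p q; set D := (msupp p `|` msupp q)%fset.
have sub : (msupp (a *: p + q) `<=` D)%fset.
  apply: fsubset_trans (msuppD_le _ _) _; apply: fsetSU; exact: msuppZ_le.
rewrite !(@linextEw f D) ?fsubsetUl ?fsubsetUr // scaler_sumr -big_split /=.
by apply: eq_bigr => t _; rewrite mcoeffD mcoeffZ scalerDl scalerA.
Qed.
HB.instance Definition _ f :=
  GRing.isLinear.Build K {malg K[T]} N *:%R (linext f) (linext_is_linear f).

Lemma linextU f t : linext f << t >> = f t.
Proof. by rewrite /linext msuppU oner_eq0 big_seq_fset1 mcoeffUU scale1r. Qed.

Lemma eq_linext f g : f =1 g -> linext f =1 linext g.
Proof. by move=> fg p; apply: eq_bigr => t _; rewrite fg. Qed.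

Lemma linextP a f g p :
  linext (fun t => a *: f t + g t) p = a *: linext f p + linext g p.
Proof.
rewrite /linext scaler_sumr -big_split /=; apply: eq_bigr => t _.
by rewrite scalerDr !scalerA mulrC.
Qed.

Lemma malg_monE p : p = \sum_(t <- msupp p) p@_t *: << t >>.
Proof.
rewrite {1}[p]monalgE; apply: eq_bigr => t _; apply/malgP => u.
by rewrite mcoeffZ !mcoeffU mulr_natr.
Qed.

(** Linearity of [h] enters as a plain hypothesis so that the lemma applies to
functions without a registered linear structure. *)
Lemma linear_monE (h : {malg K[T]} -> N) p :
  (forall a p q, h (a *: p + q) = a *: h p + h q) ->
  h p = \sum_(t <- msupp p) p@_t *: h << t >>.
Proof.
move=> hP; rewrite {1}[p]malg_monE.
elim: (enum_fset (msupp p)) => [|t s IH]; last first.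
  by rewrite big_cons [RHS]big_cons hP IH.
rewrite 2!big_nil; have := hP (-1) 0 0.
by rewrite scaler0 addr0 scaleN1r addNr.
Qed.

End LinearExtension.

Section Terms.
Variable K : fieldType.
Notation pre E V := {malg K[term (s2space E) V]}.

Section OneModule.
Variable E : s2module K.

Lemma opE (V : choiceType) (e : E) (p q : pre E V) :
  op e p q = linext (fun s => linext (fun t => << Op e s t >> : pre E V) q) p.
Proof.
rewrite /op /linext; apply: eq_bigr => s _; rewrite scaler_sumr.
by apply: eq_bigr => t _; rewrite scalerA.
Qed.

(** [op] with its tree arguments exchanged, so that linearity in the left argument
is linearity of a partial application. *)
Definition opl (V : choiceType) (e : E) (q p : pre E V) := op e p q.

Lemma opl_is_linear (V : choiceType) (e : E) (q : pre E V) : linear (opl e q).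
Proof. by move=> a p p'; rewrite /opl !opE linearP. Qed.
HB.instance Definition _ V e q :=
  GRing.isLinear.Build K _ _ _ (opl e q) (@opl_is_linear V e q).

Lemma opPl (V : choiceType) (e : E) a (p p' q : pre E V) :
  op e (a *: p + p') q = a *: op e p q + op e p' q.
Proof. exact: opl_is_linear. Qed.

Lemma op_linear_r (V : choiceType) (e : E) (p : pre E V) : linear (op e p).
Proof.
move=> a q q'; rewrite !opE; apply: etrans (linextP a _ _ p).
by apply: eq_linext => s; apply: linext_is_linear.
Qed.
HB.instance Definition _ V e p :=
  GRing.isLinear.Build K _ _ _ (op e p) (@op_linear_r V e p).

Lemma opPr (V : choiceType) (e : E) a (p q q' : pre E V) :
  op e p (a *: q + q') = a *: op e p q + op e p q'.
Proof. exact: op_linear_r. Qed.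

Lemma op0l (V : choiceType) (e : E) (q : pre E V) : op e 0 q = 0.
Proof. exact: linear0 (opl e q). Qed.

Lemma op0r (V : choiceType) (e : E) (p : pre E V) : op e p 0 = 0.
Proof. exact: linear0 (op e p). Qed.

Lemma opZl (V : choiceType) (e : E) a (p q : pre E V) :
  op e (a *: p) q = a *: op e p q.
Proof. by have := opPl e a p 0 q; rewrite op0l !addr0. Qed.

Lemma opZr (V : choiceType) (e : E) a (p q : pre E V) :
  op e p (a *: q) = a *: op e p q.
Proof. by have := opPr e a p q 0; rewrite op0r !addr0. Qed.

Lemma op_combl (V : choiceType) (e : E) a b (p p' q : pre E V) :
  op e (a *: p + b *: p') q = a *: op e p q + b *: op e p' q.
Proof. exact: etrans (opPl _ _ _ _ _) (congr1 _ (opZl _ _ _ _)). Qed.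

Lemma op_combr (V : choiceType) (e : E) a b (p q q' : pre E V) :
  op e p (a *: q + b *: q') = a *: op e p q + b *: op e p q'.
Proof. exact: etrans (opPr _ _ _ _ _) (congr1 _ (opZr _ _ _ _)). Qed.

Lemma opU (V : choiceType) (e : E) (s t : term E V) :
  op e << s >> << t >> = << Op e s t >> :> pre E V.
Proof. by rewrite opE !linextU. Qed.

Lemma pre_ind (V : choiceType) (R : pre E V -> Prop) :
  (forall t, R << t >>) -> R 0 -> (forall a p q, R p -> R q -> R (a *: p + q)) ->
  forall p, R p.
Proof.
move=> RU R0 RP p; rewrite [p]malg_monE; elim: (X in \sum_(t <- X) _) => [|t s IH].
  by rewrite big_nil.
by rewrite big_cons; apply: RP.
Qed.

(** The tool by which every identity on [op] is reduced to trees: both sides are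
bilinear in the two arguments, so they need only be compared there. *)
Lemma eq_bilinear (V : choiceType) (N : lmodType K) (h h' : pre E V -> pre E V -> N) :
  (forall q, linear (h ^~ q)) -> (forall p, linear (h p)) ->
  (forall q, linear (h' ^~ q)) -> (forall p, linear (h' p)) ->
  (forall s t, h << s >> << t >> = h' << s >> << t >>) -> h =2 h'.
Proof.
have lin0 (g : pre E V -> N) : linear g -> g 0 = 0.
  by move=> /(_ (-1) 0 0); rewrite scaler0 addr0 scaleN1r addNr.
move=> hl hr h'l h'r hh' p q; elim/pre_ind: p => [s||a p p' IH IH'].
- elim/pre_ind: q => [t||a q q' IH IH']; first exact: hh'.
    by rewrite !lin0.
  by rewrite hr h'r IH IH'.
- by rewrite (lin0 (h^~ q)) ?(lin0 (h'^~ q)).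
by rewrite (hl q) (h'l q) IH IH'.
Qed.

Variables V W : choiceType.
Implicit Types (f : V -> pre E W) (p q : pre E V).

Lemma substE f : subst f =1 linext (tsubst f).
Proof. by []. Qed.

Lemma subst_is_linear f : linear (subst f).
Proof. by move=> a p q; rewrite !substE linearP. Qed.
HB.instance Definition _ f :=
  GRing.isLinear.Build K _ _ _ (subst f) (subst_is_linear f).

Lemma substP f a p q : subst f (a *: p + q) = a *: subst f p + subst f q.
Proof. exact: subst_is_linear. Qed.

Lemma substD f p q : subst f (p + q) = subst f p + subst f q.
Proof. exact: linearD. Qed.

Lemma substB f p q : subst f (p - q) = subst f p - subst f q.
Proof. exact: linearB. Qed.

Lemma substZ f a p : subst f (a *: p) = a *: subst f p.
Proof. exact: linearZ. Qed.

Lemma subst0 f : subst f 0 = 0.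
Proof. exact: linear0. Qed.

Lemma substU f t : subst f << t >> = tsubst f t.
Proof. by rewrite substE linextU. Qed.

Lemma subst_op f e p q : subst f (op e p q) = op e (subst f p) (subst f q).
Proof.
move: p q; apply: eq_bilinear => [q a p p'|p a q q'|q a p p'|p a q q'|s t].
- by rewrite opPl substP.
- by rewrite opPr substP.
- by rewrite substP opPl.
- by rewrite substP opPr.
by rewrite opU 3!substU.
Qed.

Lemma eq_tsubst f f' t : {in leaves t, f =1 f'} -> tsubst f t = tsubst f' t.
Proof.
elim: t => /= [i ff'|e l IHl r IHr ff']; first by apply: ff'; rewrite inE.
by rewrite IHl ?IHr // => i it; apply: ff'; rewrite mem_cat it ?orbT.
Qed.

Lemma eq_subst f f' : f =1 f' -> subst f =1 subst f'.
Proof. by move=> ff'; apply: eq_linext => t; apply: eq_tsubst => i _. Qed.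

(** The set-level substitution behind [tsubst]: trees plugged into trees. *)
Fixpoint bind (f : V -> term E W) t : term E W :=
  match t with
  | Var i => f i
  | Op e l r => Op e (bind f l) (bind f r)
  end.

Lemma tsubst_bind (f : V -> term E W) t :
  tsubst (fun i => << f i >> : pre E W) t = << bind f t >>.
Proof. by elim: t => [i|e l IHl r IHr] //=; rewrite IHl IHr; apply: opU. Qed.

End OneModule.
Lemma subst_subst (E : s2module K) (U V W : choiceType) (f : U -> pre E V)
    (g : V -> pre E W) p :
  subst g (subst f p) = subst (fun i => subst g (f i)) p.
Proof.
elim/pre_ind: p => [t||a p q hp hq]; last 2 first.
- by rewrite !linear0.
- by rewrite (substP f a p) (substP g a (subst f p)) {1}hp {1}hq (substP _ a p).
rewrite !substU; elim: t => [i|e l IHl r IHr] /=; first by [].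
by rewrite subst_op IHl IHr.
Qed.

Lemma subst_id (E : s2module K) (V : choiceType) (p : pre E V) :
  subst (fun i => << Var i >>) p = p.
Proof.
elim/pre_ind: p => [t||a p q hp hq]; last 2 first.
- exact: linear0.
- by rewrite substP hp hq.
rewrite substU; elim: t => [i|e l IHl r IHr] /=; first by [].
by rewrite IHl IHr; apply: opU.
Qed.

End Terms.

(** * Change of the space of operations *)

Section Change.
Variables (K : fieldType) (E E' : s2module K) (g : {linear E -> E'}).
Local Notation pre E V := {malg K[term (s2space E) V]}.

Fixpoint term_map (V : Type) (t : term E V) : term E' V :=
  match t with
  | Var i => Var i
  | Op e l r => Op (g e) (term_map l) (term_map r)
  end.

Definition pre_map (V : choiceType) : pre E V -> pre E' V :=
  linext (fun t => << term_map t >>).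
HB.instance Definition _ V := GRing.Linear.on (@pre_map V).

Lemma pre_mapP (V : choiceType) a (p q : pre E V) :
  pre_map (a *: p + q) = a *: pre_map p + pre_map q.
Proof. exact: linearP. Qed.

Lemma pre_map0 (V : choiceType) : pre_map (0 : pre E V) = 0.
Proof. exact: linear0. Qed.

Lemma pre_mapD (V : choiceType) (p q : pre E V) :
  pre_map (p + q) = pre_map p + pre_map q.
Proof. exact: linearD. Qed.

Lemma pre_mapB (V : choiceType) (p q : pre E V) :
  pre_map (p - q) = pre_map p - pre_map q.
Proof. exact: linearB. Qed.

Lemma pre_mapZ (V : choiceType) a (p : pre E V) :
  pre_map (a *: p) = a *: pre_map p.
Proof. exact: linearZ. Qed.

Lemma pre_mapU (V : choiceType) (t : term E V) :
  pre_map << t >> = << term_map t >>.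
Proof. exact: linextU. Qed.

Lemma pre_map_op (V : choiceType) e (p q : pre E V) :
  pre_map (op e p q) = op (g e) (pre_map p) (pre_map q).
Proof.
move: p q; apply: eq_bilinear => [q a p p'|p a q q'|q a p p'|p a q q'|s t].
- by rewrite opPl pre_mapP.
- by rewrite opPr pre_mapP.
- by rewrite pre_mapP opPl.
- by rewrite pre_mapP opPr.
by rewrite opU 3!pre_mapU; symmetry; apply: opU.
Qed.

Lemma pre_map_subst (V W : choiceType) (f : V -> pre E W) (p : pre E V) :
  pre_map (subst f p) = subst (fun i => pre_map (f i)) (pre_map p).
Proof.
elim/pre_ind: p => [t||a p q hp hq]; last 2 first.
- by rewrite !linear0.
- by rewrite (substP f) (pre_mapP a (subst f p)) {1}hp {1}hq pre_mapP substP.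
rewrite pre_mapU 2!substU; elim: t => [i|e l IHl r IHr] /=; first by [].
by rewrite pre_map_op IHl IHr.
Qed.

Lemma pre_map_relabel (V W : choiceType) (f : V -> W) (p : pre E V) :
  pre_map (relabel f p) = relabel f (pre_map p).
Proof.
rewrite /relabel pre_map_subst; apply: eq_subst => i.
exact: pre_mapU.
Qed.

Lemma leaves_term_map (V : Type) (t : term E V) : leaves (term_map t) = leaves t.
Proof. by elim: t => //= e l -> r ->. Qed.

Lemma msupp_pre_map (V : choiceType) (p : pre E V) t :
  t \in msupp (pre_map p) -> exists2 s, s \in msupp p & t = term_map s.
Proof.
rewrite -mcoeff_neq0 /pre_map /linext raddf_sum /=.
case: (boolP (has (fun s => term_map s == t) (msupp p))) => [/hasP|/hasPn no].
  by case=> s sp /eqP <- _; exists s.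
rewrite big_seq big1 ?eqxx // => s /no /negPf st.
by rewrite mcoeffZ mcoeffU st mulr0.
Qed.

Lemma pre_map_arity (V : choiceType) (A : seq V) (p : pre E V) :
  arity A p -> arity A (pre_map p).
Proof. by move=> pA t /msupp_pre_map [s sp ->]; rewrite leaves_term_map pA. Qed.

End Change.

Lemma pre_mapK (K : fieldType) (E E' : s2module K)
    (g : {linear E -> E'}) (g' : {linear E' -> E}) (V : choiceType) :
  cancel g g' -> cancel (@pre_map K E E' g V) (@pre_map K E' E g' V).
Proof.
move=> gK; elim/pre_ind => [t||a p q hp hq].
- rewrite 2!pre_mapU; congr << _ >>.
  by elim: t => //= e l -> r ->; rewrite gK.
- by rewrite !linear0.
by rewrite (pre_mapP g) pre_mapP {1}hp {1}hq.
Qed.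

(** * Congruence modulo the relations *)

Section Ideal.
Variables (K : fieldType) (Q : @quadratic K).
Local Notation pre E V := {malg K[term (s2space E) V]}.
Local Notation E := (gen Q).

Lemma idealB (V : choiceType) (p q : pre E V) : ideal p -> ideal q -> ideal (p - q).
Proof. by move=> hp hq; rewrite -scaleN1r; apply: idealD => //; apply: idealZ. Qed.

Lemma ideal_sum (V : choiceType) I (r : seq I) (P : pred I) (F : I -> pre E V) :
  (forall i, P i -> ideal (F i)) -> ideal (\sum_(i <- r | P i) F i).
Proof. by move=> hF; elim/big_ind: _ => //; [apply: ideal0 | apply: idealD]. Qed.

Lemma eqmod_refl (V : choiceType) (p : pre E V) : eqmod p p.
Proof. by rewrite /eqmod subrr; apply: ideal0. Qed.

Lemma eqmod_sym (V : choiceType) (p q : pre E V) : eqmod p q -> eqmod q p.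
Proof. by move=> h; rewrite /eqmod -opprB -scaleN1r; apply: idealZ. Qed.

Lemma eqmod_trans (V : choiceType) (q p r : pre E V) :
  eqmod p q -> eqmod q r -> eqmod p r.
Proof. by move=> h h'; rewrite /eqmod -(subrKA q); apply: idealD. Qed.

(** Replacing both sides by equal terms without rewriting inside the goal. *)
Lemma eqmod_eq (V : choiceType) (p p' q q' : pre E V) :
  p = p' -> q = q' -> eqmod p' q' -> eqmod p q.
Proof. by move=> -> ->. Qed.

Lemma eqmodD (V : choiceType) (p p' q q' : pre E V) :
  eqmod p p' -> eqmod q q' -> eqmod (p + q) (p' + q').
Proof. by move=> h h'; rewrite /eqmod opprD addrACA; apply: idealD. Qed.

Lemma eqmodZ (V : choiceType) a (p p' : pre E V) :
  eqmod p p' -> eqmod (a *: p) (a *: p').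
Proof. by move=> h; rewrite /eqmod -scalerBr; apply: idealZ. Qed.

Lemma eqmodN (V : choiceType) (p p' : pre E V) : eqmod p p' -> eqmod (- p) (- p').
Proof. by move=> h; rewrite -scaleN1r -(scaleN1r p'); apply: eqmodZ. Qed.

Lemma eqmodB (V : choiceType) (p p' q q' : pre E V) :
  eqmod p p' -> eqmod q q' -> eqmod (p - q) (p' - q').
Proof. by move=> h h'; apply: eqmodD => //; apply: eqmodN. Qed.

Lemma eqmod_ideal (V : choiceType) (p q : pre E V) : eqmod p q -> ideal q -> ideal p.
Proof. by move=> h hq; rewrite -(subrK q p); apply: idealD. Qed.

Lemma eqmod_op (V : choiceType) (e : E) (p p' q q' : pre E V) :
  eqmod p p' -> eqmod q q' -> eqmod (op e p q) (op e p' q').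
Proof.
move=> h h'; apply: (@eqmod_trans _ (op e p' q)); rewrite /eqmod.
  by rewrite -/(opl e q p) -/(opl e q p') -linearB; apply: ideal_opl.
by rewrite -linearB; apply: ideal_opr.
Qed.

Lemma eqmod_sum (V : choiceType) I (r : seq I) (F G : I -> pre E V) :
  (forall i, eqmod (F i) (G i)) -> eqmod (\sum_(i <- r) F i) (\sum_(i <- r) G i).
Proof. by move=> h; rewrite /eqmod -sumrB; apply: ideal_sum => i _; apply: h. Qed.

Lemma eqmod_sum_seq (V : choiceType) (I : eqType) (r : seq I) (F G : I -> pre E V) :
  {in r, forall i, eqmod (F i) (G i)} ->
  eqmod (\sum_(i <- r) F i) (\sum_(i <- r) G i).
Proof.
move=> h; rewrite /eqmod -sumrB big_seq; apply: ideal_sum => i; exact: h.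
Qed.

Lemma eqmod_lin (V : choiceType) a (e f : E) (p q : pre E V) :
  eqmod (op (a *: e + f) p q) (a *: op e p q + op f p q).
Proof.
rewrite /op scaler_sumr -big_split; apply: eqmod_sum => s /=.
rewrite scaler_sumr -big_split; apply: eqmod_sum => t /=.
rewrite (scalerA a) [a * _]mulrC -(scalerA _ a) -scalerDr; apply: eqmodZ.
exact: ideal_lin.
Qed.

(** The ideal contains this congruence for trees only; bilinearity extends it to
all arguments, as for [eqmod_lin]. *)
Lemma eqmod_flip (V : choiceType) (e : E) (p q : pre E V) :
  eqmod (op e p q) (op (flip e) q p).
Proof.
rewrite /op [X in eqmod _ X]exchange_big; apply: eqmod_sum => s /=.
apply: eqmod_sum => t; rewrite [q@_t * _]mulrC; apply: eqmodZ.
exact: ideal_flip.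
Qed.

(** Stability under trees substituted for the variables, which is what makes the
relations usable at arbitrary arguments. *)
Lemma ideal_subst_term (V W : choiceType) (f : V -> term E W) (p : pre E V) :
  ideal p -> ideal (subst (fun i => << f i >>) p).
Proof.
elim=> {p} [|p q _ hp _ hq|a p _ hp|a e e' s t|e s t|r h rr|e p q _ hp|e p q _ hq].
- by rewrite subst0; apply: ideal0.
- by rewrite substD; apply: idealD.
- by rewrite substZ; apply: idealZ.
- rewrite substB substD substZ {1}substU {1}substU {1}substU.
  exact: (eqmod_lin a e e' (tsubst _ s) (tsubst _ t)).
- rewrite substB {1}substU {1}substU; exact: (eqmod_flip e (tsubst _ s) (tsubst _ t)).
- rewrite subst_subst.
  rewrite (eq_subst (f' := fun i => << bind f (h i) >>)); first exact: ideal_rel.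
  by move=> i; rewrite substU tsubst_bind.
- by rewrite subst_op; apply: ideal_opl.
by rewrite subst_op; apply: ideal_opr.
Qed.

End Ideal.

(** * Isomorphisms induced by maps of generators *)

Section Isomorphism.
Variable K : fieldType.
Local Notation pre E V := {malg K[term (s2space E) V]}.

(** The ideal is generated by elements that a map of S_2-modules respects, apart
from the relations themselves, so only these have to be checked. *)
Lemma ideal_pre_map (P Q : @quadratic K) (g : {linear gen P -> gen Q}) :
  (forall e, g (flip e) = flip (g e)) ->
  (forall r, relations r -> ideal (pre_map g r)) ->
  forall (V : choiceType) (p : pre (gen P) V), ideal p -> ideal (pre_map g p).
Proof.
move=> gF gR V p.
elim=> {p} [|p q _ hp _ hq|a p _ hp|a e e' s t|e s t|r h rr|e p q _ hp|e p q _ hq].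
- by rewrite pre_map0; apply: ideal0.
- by rewrite pre_mapD; apply: idealD.
- by rewrite pre_mapZ; apply: idealZ.
- rewrite pre_mapB pre_mapD pre_mapZ {1}pre_mapU {1}pre_mapU {1}pre_mapU /= linearP.
  exact: ideal_lin.
- rewrite pre_mapB {1}pre_mapU {1}pre_mapU /= gF; exact: ideal_flip.
- rewrite pre_map_subst (eq_subst (f' := fun i => << term_map g (h i) >>)).
    by apply: ideal_subst_term; apply: gR.
  by move=> i; apply: pre_mapU.
- by rewrite pre_map_op; apply: ideal_opl.
by rewrite pre_map_op; apply: ideal_opr.
Qed.

(** The inverse map on generators gives both injectivity and surjectivity; all
compatibilities with the operad structure hold already before passing to the
quotients. *)
Lemma operad_iso_pre_map (P Q : @quadratic K)
    (g : {linear gen P -> gen Q}) (g' : {linear gen Q -> gen P}) :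
  cancel g g' -> cancel g' g -> (forall e, g (flip e) = flip (g e)) ->
  (forall r, relations r -> ideal (pre_map g r)) ->
  (forall r, relations r -> ideal (pre_map g' r)) ->
  operad_iso (@pre_map K (gen P) (gen Q) g nat).
Proof.
move=> gK g'K gF gR g'R.
have g'F e : g' (flip e) = flip (g' e).
  by apply: (can_inj gK); rewrite gF !g'K.
split=> [A p _|A p _ _|A q _ qA|i|A f p _ _ _|A B a p q _ _ _ _ _ _].
- exact: pre_map_arity.
- split; first exact: ideal_pre_map.
  by move/(ideal_pre_map g'F g'R); rewrite (pre_mapK gK).
- exists (pre_map g' q); first exact: pre_map_arity.
  by rewrite /= (pre_mapK g'K); apply: eqmod_refl.
- by rewrite /xvar /= pre_mapU; apply: eqmod_refl.
- by rewrite /= pre_map_relabel; apply: eqmod_refl.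
rewrite /pcomp /= pre_map_subst (eq_subst (f' := fun i =>
  if i == a then pre_map g q else xvar (gen Q) i)); first exact: eqmod_refl.
by move=> i; case: eqP => // _; apply: pre_mapU.
Qed.

End Isomorphism.

(** * Novikov identities and the dual generators *)

Section Duality.
Variable K : fieldType.
Local Notation E := (regular K).
Local Notation m := (mu K : s2space (regular K)).
Local Notation pre V := {malg K[term (s2space E) V]}.

Definition lassoc V (e : E) (s t u : term E V) := Op e (Op e s t) u.
Definition rassoc V (e : E) (s t u : term E V) := Op e s (Op e t u).
Definition assoc (V : choiceType) (e : E) s t u : pre V :=
  << rassoc e s t u >> - << lassoc e s t u >>.

(** The assignment of three values to the three variables of a relator. *)
Definition triple (V : Type) (s t u : V) (i : 'I_3) : V :=
  match val i with 0 => s | 1 => t | _ => u end.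

Section Relators.
Variable V : choiceType.
Implicit Types s t u : term E V.

Lemma subst_monomial (f : 'I_3 -> term E V) w :
  subst (fun i => << f i >> : pre V) << w >> = << bind f w >>.
Proof. by rewrite substU; apply: tsubst_bind. Qed.

Lemma subst_associator (f : 'I_3 -> term E V) x y z :
  subst (fun i => << f i >>) (associator x y z)
  = assoc m (bind f x) (bind f y) (bind f z).
Proof. by rewrite substB; congr (_ - _); apply: subst_monomial. Qed.

Lemma left_novikov_rc s t u :
  ideal (Q := left_novikov K) (<< lassoc m s t u >> - << lassoc m s u t >>).
Proof.
have := ideal_rel (Q := left_novikov K) (triple s t u) (S3_gen (or_introl erefl)).
by rewrite substB; congr (ideal (_ - _)); apply: subst_monomial.
Qed.

Lemma left_novikov_ls s t u :
  ideal (Q := left_novikov K) (assoc m s t u - assoc m t s u).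
Proof.
have := ideal_rel (Q := left_novikov K) (triple s t u) (S3_gen (or_intror erefl)).
by rewrite substB; congr (ideal (_ - _)); apply: subst_associator.
Qed.

Lemma right_novikov_lc s t u :
  ideal (Q := right_novikov K) (<< rassoc m s t u >> - << rassoc m t s u >>).
Proof.
have := ideal_rel (Q := right_novikov K) (triple s t u) (S3_gen (or_introl erefl)).
by rewrite substB; congr (ideal (_ - _)); apply: subst_monomial.
Qed.

Lemma right_novikov_rs s t u :
  ideal (Q := right_novikov K) (assoc m s t u - assoc m s u t).
Proof.
have := ideal_rel (Q := right_novikov K) (triple s t u) (S3_gen (or_intror erefl)).
by rewrite substB; congr (ideal (_ - _)); apply: subst_associator.
Qed.

End Relators.

(** The isomorphism E^v -> E of S_2-modules; the sign absorbs the twist by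
sgn_2. *)
Definition undual (f : s2dual E) : E := (f (1, 0), - f (0, 1)).

Lemma undual_is_linear : linear undual.
Proof.
move=> a f g; rewrite /undual !lfunE /= !lfunE /= opprD -mulrN.
by congr (_, _).
Qed.
HB.instance Definition _ := GRing.isLinear.Build K _ _ _ undual undual_is_linear.

Definition redual (v : E) : s2dual E := v.1 *: mu_dual K + v.2 *: flip (mu_dual K).

Lemma redual_is_linear : linear redual.
Proof.
by move=> a v w; rewrite /redual !scalerDl scalerDr !scalerA addrACA.
Qed.
HB.instance Definition _ := GRing.isLinear.Build K _ _ _ redual redual_is_linear.

Lemma mu_dualE v : mu_dual K v = v.1.
Proof. exact: lfunE. Qed.

Lemma dual_flipE (f : s2dual E) v : (flip f : 'Hom(E, K^o)) v = - f (swap v).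
Proof. by rewrite /= /dual_flip opp_lfunE comp_lfunE lfunE. Qed.

Lemma redualE v w : redual v w = v.1 * w.1 - v.2 * w.2.
Proof.
by rewrite /redual add_lfunE !scale_lfunE dual_flipE !mu_dualE -mulrN.
Qed.

Lemma redualK : cancel redual undual.
Proof.
case=> x y; rewrite /undual !redualE /= !mulr0 !mulr1 subr0 sub0r opprK.
by [].
Qed.

Lemma undualK : cancel undual redual.
Proof.
move=> f; apply/lfunP=> -[x y]; rewrite redualE /= mulNr opprK.
have -> : (x, y) = x *: (1, 0) + y *: (0, 1) :> K^o * K^o.
  by congr (_, _); rewrite /= !scaler0 ?addr0 ?add0r [_ *: _]mulr1.
by rewrite linearD !linearZ /= ![_ *: _]mulrC.
Qed.

Lemma undual_flip f : undual (flip f) = flip (undual f).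
Proof. by rewrite /undual !dual_flipE opprK. Qed.

End Duality.

(** * The pairing in arity three *)

Section Pairing.
Variables (K : fieldType) (E : s2module K).
Local Notation pre E := {malg K[term (s2space E) 'I_3]}.

Lemma pairingE (q : pre (s2dual E)) (p : pre E) :
  pairing q p = linext (fun u : term (s2dual E) 'I_3 =>
    linext (fun t : term E 'I_3 => tree_pairing u t : K^o) p) q.
Proof.
rewrite /pairing /linext; apply: eq_bigr => u _; rewrite scaler_sumr.
by apply: eq_bigr => t _; rewrite scalerA.
Qed.

Lemma pairingU u t :
  pairing (<< u >> : pre (s2dual E)) (<< t >> : pre E) = tree_pairing u t.
Proof. by rewrite pairingE !linextU. Qed.

Lemma pairingBl (q q' : pre (s2dual E)) (p : pre E) :
  pairing (q - q') p = pairing q p - pairing q' p.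
Proof. by rewrite !pairingE linearB. Qed.

Lemma pairingPl a (q q' : pre (s2dual E)) (p : pre E) :
  pairing (a *: q + q') p = a * pairing q p + pairing q' p.
Proof. by rewrite !pairingE linearP. Qed.

Lemma pairingPr a (q : pre (s2dual E)) (p p' : pre E) :
  pairing q (a *: p + p') = a * pairing q p + pairing q p'.
Proof.
rewrite !pairingE.
pose h p0 (u : term (s2dual E) 'I_3) :=
  linext (fun t : term E 'I_3 => tree_pairing u t : K^o) p0.
transitivity (linext (fun u => a *: h p u + h p' u : K^o) q).
  by apply: (@eq_linext _ _ _ (h (a *: p + p'))) => u; apply: linext_is_linear.
exact: (linextP a (h p) (h p') q).
Qed.

Lemma pairing0r (q : pre (s2dual E)) : pairing q (0 : pre E) = 0.
Proof.
by rewrite -[0](subrr 0) -scaleN1r addrC pairingPr mulN1r addNr.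
Qed.

Lemma pairingBr (q : pre (s2dual E)) (p p' : pre E) :
  pairing q (p - p') = pairing q p - pairing q p'.
Proof. by rewrite -scaleN1r addrC pairingPr mulN1r addrC. Qed.

End Pairing.

Section Annihilator.
Variables (K : fieldType) (Q : @quadratic K).
Local Notation pre E := {malg K[term (s2space E) 'I_3]}.

(** By bilinearity it is enough to test the relators and their permutations. *)
Lemma annihilatorP (q : pre (s2dual (gen Q))) :
  arity (enum 'I_3) q ->
  (forall r (s : 'S_3), relators r -> pairing q (relabel s r) = 0) ->
  annihilator q.
Proof.
move=> qA qr; split=> // r rr.
suff h (s : 'S_3) : pairing q (relabel s r) = 0.
  apply: etrans _ (h 1%g); apply: (congr1 (pairing q)); apply: etrans (esym (subst_id r)) _.
  by apply: eq_subst => i; rewrite perm1.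
elim: rr s => {r} [r rr s||a p p' _ hp _ hp' s|s' p _ hp s].
- exact: qr.
- by move=> s; rewrite /relabel subst0 pairing0r.
- rewrite /relabel substP pairingPr.
  apply: etrans (congr2 (fun x y => a * x + y) (hp s) (hp' s)) _.
  by rewrite mulr0 addr0.
have -> : relabel s (relabel s' p) = relabel (s' * s)%g p; last exact: hp.
apply: etrans (subst_subst _ _ p) _.
by apply: eq_subst => i; rewrite substU /= permM.
Qed.

End Annihilator.

Section NovikovPairing.
Variable K : fieldType.
Local Notation E := (regular K).
Local Notation m := (mu K : s2space (regular K)).
Local Notation redual := (@redual K).
Local Notation pre E := {malg K[term (s2space E) 'I_3]}.

Definition left_monomial (i j k : 'I_3) := lassoc m (Var i) (Var j) (Var k).
Definition right_monomial (i j k : 'I_3) := rassoc m (Var i) (Var j) (Var k).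

(** These four values say that the twelve monomials (ab)c and a(bc) form an
orthogonal basis; in a(bc) the root operation is read through [flip], which
rotates the arguments and contributes a sign. *)
Lemma tree_pairing_ll i j k i' j' k' :
  tree_pairing (term_map redual (left_monomial i j k)) (left_monomial i' j' k')
  = if (i', j', k') == (i, j, k) then sgn3 i j k else 0 :> K.
Proof.
rewrite /tree_pairing /= !redualE /=.
by rewrite !(mulr1, mulr0, subr0); case: eqP => // _; rewrite if_same.
Qed.

Lemma tree_pairing_lr i j k i' j' k' :
  tree_pairing (term_map redual (left_monomial i j k)) (right_monomial i' j' k') = 0.
Proof.
rewrite /tree_pairing /= !redualE /=.
by rewrite !(mulr1, mulr0, subr0, mul0r) !if_same.
Qed.

Lemma tree_pairing_rl i j k i' j' k' :
  tree_pairing (term_map redual (right_monomial i j k)) (left_monomial i' j' k') = 0.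
Proof.
rewrite /tree_pairing /= !dual_flipE !redualE /=.
by rewrite !(mulr1, mulr0, subr0, oppr0, mul0r) !if_same.
Qed.

Lemma tree_pairing_rr i j k i' j' k' :
  tree_pairing (term_map redual (right_monomial i j k)) (right_monomial i' j' k')
  = if (j', k', i') == (j, k, i) then - sgn3 j k i else 0 :> K.
Proof.
rewrite /tree_pairing /= !dual_flipE !redualE /=.
rewrite !(mulr1, mulr0, subr0, oppr0, mul0r, mulrN1); case: eqP => // _.
by rewrite if_same.
Qed.

Lemma relabel_lm (s : 'S_3) i j k :
  relabel s (<< left_monomial i j k >> : pre E) = << left_monomial (s i) (s j) (s k) >>.
Proof. by rewrite /relabel subst_monomial. Qed.

Lemma relabel_rm (s : 'S_3) i j k :
  relabel s (<< right_monomial i j k >> : pre E) = << right_monomial (s i) (s j) (s k) >>.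
Proof. by rewrite /relabel subst_monomial. Qed.

Lemma relabelB (s : 'S_3) (p q : pre E) :
  relabel s (p - q) = relabel s p - relabel s q.
Proof. exact: substB. Qed.

End NovikovPairing.

(** * Orthogonality of the two systems of relators *)

Section RelatorsAnnihilate.
Variable K : fieldType.
Local Notation E := (regular K).
Local Notation m := (mu K : s2space (regular K)).
Local Notation redual := (@redual K).
Local Notation pre E := {malg K[term (s2space E) 'I_3]}.
Local Notation left_monomial := (@left_monomial K).
Local Notation right_monomial := (@right_monomial K).

(** The pairing of an element, moved to the dual side, with a permuted element:
the annihilator condition for relators, one permutation at a time. *)
Definition bracket (s : 'S_3) (q p : pre E) :=
  pairing (pre_map redual q) (relabel s p).

Lemma bracketBl s q q' p : bracket s (q - q') p = bracket s q p - bracket s q' p.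
Proof. by rewrite /bracket pre_mapB; apply: pairingBl. Qed.

Lemma bracketBr s q p p' : bracket s q (p - p') = bracket s q p - bracket s q p'.
Proof. by rewrite /bracket relabelB; apply: pairingBr. Qed.

Lemma bracket_ll s i j k i' j' k' :
  bracket s << left_monomial i j k >> << left_monomial i' j' k' >>
  = if (s i', s j', s k') == (i, j, k) then sgn3 i j k else 0.
Proof.
rewrite /bracket relabel_lm (pre_mapU redual (left_monomial i j k)).
by apply: etrans (pairingU _ _) _; apply: tree_pairing_ll.
Qed.

Lemma bracket_lr s i j k i' j' k' :
  bracket s << left_monomial i j k >> << right_monomial i' j' k' >> = 0.
Proof.
rewrite /bracket relabel_rm (pre_mapU redual (left_monomial i j k)).
by apply: etrans (pairingU _ _) _; apply: tree_pairing_lr.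
Qed.

Lemma bracket_rl s i j k i' j' k' :
  bracket s << right_monomial i j k >> << left_monomial i' j' k' >> = 0.
Proof.
rewrite /bracket relabel_lm (pre_mapU redual (right_monomial i j k)).
by apply: etrans (pairingU _ _) _; apply: tree_pairing_rl.
Qed.

Lemma bracket_rr s i j k i' j' k' :
  bracket s << right_monomial i j k >> << right_monomial i' j' k' >>
  = if (s j', s k', s i') == (j, k, i) then - sgn3 j k i else 0.
Proof.
rewrite /bracket relabel_rm (pre_mapU redual (right_monomial i j k)).
by apply: etrans (pairingU _ _) _; apply: tree_pairing_rr.
Qed.

Local Notation o0 := (@Ordinal 3 0 isT).
Local Notation o1 := (@Ordinal 3 1 isT).
Local Notation o2 := (@Ordinal 3 2 isT).

Lemma ord3_perm (R : 'I_3 -> 'I_3 -> 'I_3 -> Prop) :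
  R o0 o1 o2 -> R o0 o2 o1 -> R o1 o0 o2 -> R o1 o2 o0 -> R o2 o0 o1 -> R o2 o1 o0 ->
  forall i j k, uniq [:: i; j; k] -> R i j k.
Proof.
move=> h1 h2 h3 h4 h5 h6 i j k.
by case: i => [[|[|[|i]]] hi]; case: j => [[|[|[|j]]] hj];
  case: k => [[|[|[|k]]] hk] //= _; rewrite (bool_irrelevance hi isT)
    (bool_irrelevance hj isT) (bool_irrelevance hk isT).
Qed.

(* Expansion by bilinearity along the syntax, one step at a time: rewriting with
   the expansion lemmas would compare unrelated linear combinations. *)
Ltac bracket_expand :=
  lazymatch goal with
  | |- bracket _ (_ - _) _ = _ =>
      refine (etrans (bracketBl _ _ _ _) (congr2 (fun x y => x - y) _ _));
      bracket_expand
  | |- bracket _ _ (_ - _) = _ =>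
      refine (etrans (bracketBr _ _ _ _) (congr2 (fun x y => x - y) _ _));
      bracket_expand
  | |- bracket _ << left_monomial _ _ _ >> << left_monomial _ _ _ >> = _ => exact (bracket_ll _ _ _ _ _ _ _)
  | |- bracket _ << left_monomial _ _ _ >> << right_monomial _ _ _ >> = _ => exact (bracket_lr _ _ _ _ _ _ _)
  | |- bracket _ << right_monomial _ _ _ >> << left_monomial _ _ _ >> = _ => exact (bracket_rl _ _ _ _ _ _ _)
  | |- bracket _ << right_monomial _ _ _ >> << right_monomial _ _ _ >> = _ => exact (bracket_rr _ _ _ _ _ _ _)
  end.

Ltac bracket0 :=
  refine (etrans (y := _) _ _); [bracket_expand | cbv beta].

Definition left_rc i j k : pre E := << left_monomial i j k >> - << left_monomial i k j >>.
Definition assoc3 i j k : pre E := << right_monomial i j k >> - << left_monomial i j k >>.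
Definition right_lc i j k : pre E := << right_monomial i j k >> - << right_monomial j i k >>.
Lemma perm_ord3_uniq (s : 'S_3) : uniq [:: s o0; s o1; s o2].
Proof. by rewrite (map_inj_uniq perm_inj [:: o0; o1; o2]). Qed.

Ltac bracket_calc s :=
  split; rewrite /right_lc /left_rc /assoc3; bracket0;
  move: (s o0) (s o1) (s o2) (perm_ord3_uniq s); apply: ord3_perm;
  rewrite ?xpair_eqE -?val_eqE /sgn3 /=; ring.

Lemma bracket_right_left s :
  [/\ bracket s (right_lc o0 o1 o2) (left_rc o0 o1 o2) = 0,
      bracket s (right_lc o0 o1 o2) (assoc3 o0 o1 o2 - assoc3 o1 o0 o2) = 0,
      bracket s (assoc3 o0 o1 o2 - assoc3 o0 o2 o1) (left_rc o0 o1 o2) = 0 &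
      bracket s (assoc3 o0 o1 o2 - assoc3 o0 o2 o1) (assoc3 o0 o1 o2 - assoc3 o1 o0 o2) = 0].
Proof. by bracket_calc s. Qed.

Lemma bracket_left_right s :
  [/\ bracket s (left_rc o0 o1 o2) (right_lc o0 o1 o2) = 0,
      bracket s (left_rc o0 o1 o2) (assoc3 o0 o1 o2 - assoc3 o0 o2 o1) = 0,
      bracket s (assoc3 o0 o1 o2 - assoc3 o1 o0 o2) (right_lc o0 o1 o2) = 0 &
      bracket s (assoc3 o0 o1 o2 - assoc3 o1 o0 o2) (assoc3 o0 o1 o2 - assoc3 o0 o2 o1) = 0].
Proof. by bracket_calc s. Qed.

Lemma right_annihilates_left r :
  right_novikov_relators r -> annihilator (Q := left_novikov K) (pre_map redual r).
Proof.
move=> rr; apply: annihilatorP => [|r' s].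
  by apply: pre_map_arity; apply: right_novikov_arity.
have [h1 h2 h3 h4] := bracket_right_left s.
by case: rr => ->; case=> ->; [exact: h1|exact: h2|exact: h3|exact: h4].
Qed.

Lemma left_annihilates_right r :
  left_novikov_relators r -> annihilator (Q := right_novikov K) (pre_map redual r).
Proof.
move=> rr; apply: annihilatorP => [|r' s].
  by apply: pre_map_arity; apply: left_novikov_arity.
have [h1 h2 h3 h4] := bracket_left_right s.
by case: rr => ->; case=> ->; [exact: h1|exact: h2|exact: h3|exact: h4].
Qed.

End RelatorsAnnihilate.

(** * Elements orthogonal to the relators *)

Section Combination.
Variables (K : fieldType) (V : lmodType K).
Implicit Types l r : 'I_3 -> 'I_3 -> 'I_3 -> V.
Local Notation o0 := (@Ordinal 3 0 isT).
Local Notation o1 := (@Ordinal 3 1 isT).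
Local Notation o2 := (@Ordinal 3 2 isT).

Definition perms3 := [:: (o0, o1, o2); (o0, o2, o1); (o1, o0, o2); (o1, o2, o0); (o2, o0, o1); (o2, o1, o0)].
(** The cyclic orders: since each relation exchanges two neighbouring letters, one
representative per pair suffices in the combinations below. *)
Definition even3 := [:: (o0, o1, o2); (o1, o2, o0); (o2, o0, o1)].

(** The element whose pairings with the monomials [l] = (ij)k and [r] = i(jk) are
[P] and [M]: the expansion in an orthogonal basis of vectors of square +1 or -1. *)
Definition coordinates l r (P M : 'I_3 -> 'I_3 -> 'I_3 -> K) : V :=
  \sum_(x <- perms3) let: (i, j, k) := x in
    ((sgn3 i j k * P i j k) *: l i j k - (sgn3 i j k * M i j k) *: r i j k).

Lemma coordinatesP l r a P M P' M' :
  coordinates l r (fun i j k => a * P i j k + P' i j k)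
    (fun i j k => a * M i j k + M' i j k)
  = a *: coordinates l r P M + coordinates l r P' M'.
Proof.
rewrite /coordinates scaler_sumr -big_split; apply: eq_bigr => -[[i j] k] _.
rewrite scalerBr !scalerA !mulrDr !scalerDl opprD addrACA.
by congr (_ *: _ - _ *: _ + _); ring.
Qed.

Lemma eq_coordinates l r P M P' M' :
  (forall i j k, P i j k = P' i j k) -> (forall i j k, M i j k = M' i j k) ->
  coordinates l r P M = coordinates l r P' M'.
Proof. by move=> hP hM; apply: eq_bigr => -[[i j] k] _; rewrite hP hM. Qed.

(* The identities below are between vectors of [V]; they are stated after applying
   a linear form [phi], which turns them into ring identities in [K]. *)
Variable phi : V -> K.
Hypothesis phi_linear : forall a u v, phi (a *: u + v) = a * phi u + phi v.

Lemma phiD u v : phi (u + v) = phi u + phi v.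
Proof. by rewrite -[u]scale1r phi_linear mul1r scale1r. Qed.

Lemma phi0 : phi 0 = 0.
Proof. by apply: (@addrI _ (phi 0)); rewrite -phiD !addr0. Qed.

Lemma phiZ a u : phi (a *: u) = a * phi u.
Proof. by rewrite -[a *: u]addr0 phi_linear phi0 addr0. Qed.

Lemma phiN u : phi (- u) = - phi u.
Proof. by rewrite -scaleN1r phiZ mulN1r. Qed.

Ltac phi_expand :=
  lazymatch goal with
  | |- phi (_ + _) = _ => refine (etrans (phiD _ _) (congr2 (fun x y => x + y) _ _)); phi_expand
  | |- phi (- _) = _ => refine (etrans (phiN _) (congr1 (fun x => - x) _)); phi_expand
  | |- phi (_ *: _) = _ => refine (etrans (phiZ _ _) (congr1 (fun x => _ * x) _)); phi_expand
  | |- phi 0 = _ => exact phi0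
  | |- _ => reflexivity
  end.

Ltac phi_linear :=
  refine (etrans (y := _) _ (esym (etrans (y := _) _ _)));
  [phi_expand | phi_expand | cbv beta].

(** The expansion of a tree e(e'(a, b), c): only the four trees supported on the
same leaf c at the root contribute. *)
Lemma coordinates_monomial l r a b c (x y x' y' : K) : uniq [:: a; b; c] ->
  phi (coordinates l r
    (fun i j k => if (i, j, k) == (a, b, c) then sgn3 a b c * (x * x')
       else if (i, j, k) == (b, a, c) then sgn3 a b c * (x * - y') else 0)
    (fun i j k => if (j, k, i) == (a, b, c) then sgn3 a b c * (- y * x')
       else if (j, k, i) == (b, a, c) then sgn3 a b c * (- y * - y') else 0))
  = phi (x *: (x' *: l a b c + y' *: l b a c) + y *: (x' *: r c a b + y' *: r c b a)).
Proof.
move: a b c; apply: ord3_perm; rewrite /coordinates !big_cons !big_nil /sgn3 /=;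
  phi_linear; ring.
Qed.

(** [hP] and [hM] say that the left-Novikov relators are annihilated; they allow
the coordinates of the odd permutations to be eliminated, and what is left
regroups into right-Novikov relators. *)
Lemma coordinates_right l r P M :
  (forall i j k, uniq [:: i; j; k] -> P i j k = P i k j) ->
  (forall i j k, uniq [:: i; j; k] -> M i j k - P i j k = M j i k - P j i k) ->
  phi (coordinates l r P M) =
  phi (\sum_(x <- even3) let: (i, j, k) := x in
    ((P i j k - M i j k) *: (r i j k - r j i k)
     - P i j k *: ((r i j k - l i j k) - (r i k j - l i k j)))).
Proof.
move=> hP hM; rewrite /coordinates !big_cons !big_nil /sgn3 /=.
phi_linear.
have e i j k : uniq [:: i; j; k] -> M i j k = M j i k - P j i k + P i j k.
  by move=> u; rewrite -hM // subrK.
rewrite (e o1 o0 o2) // (e o0 o2 o1) // (e o2 o1 o0) //.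
rewrite (hP o0 o2) // (hP o1 o2) // (hP o2 o1) //; ring.
Qed.

(** The mirror image of [coordinates_right]. *)
Lemma coordinates_left l r P M :
  (forall i j k, uniq [:: i; j; k] -> M i j k = M j i k) ->
  (forall i j k, uniq [:: i; j; k] -> M i j k - P i j k = M i k j - P i k j) ->
  phi (coordinates l r P M) =
  phi (\sum_(x <- even3) let: (i, j, k) := x in
    ((P i j k - M i j k) *: (l i j k - l i k j)
     - M i j k *: ((r i j k - l i j k) - (r j i k - l j i k)))).
Proof.
move=> hM hP; rewrite /coordinates !big_cons !big_nil /sgn3 /=.
phi_linear.
have e i j k : uniq [:: i; j; k] -> P i j k = P i k j - M i k j + M i j k.
  by move=> u; rewrite -[P i k j - _]opprB -hP // opprB subrK.
rewrite (e o0 o2 o1) // (e o1 o0 o2) // (e o2 o1 o0) //.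
rewrite (hM o1 o0) // (hM o2 o1) // (hM o0 o2) //; ring.
Qed.

End Combination.

Section Trees.
Variables (K : fieldType) (E : s2module K).

Lemma size_leaves_gt0 V (t : term E V) : (0 < size (leaves t))%N.
Proof. by elim: t => //= e l hl r _; rewrite size_cat ltn_addr. Qed.

Lemma leaves1 V (t : term E V) : size (leaves t) = 1%N -> exists i, t = Var i.
Proof.
case: t => [i _|e l r /=]; first by exists i.
rewrite size_cat; have := size_leaves_gt0 l; have := size_leaves_gt0 r.
by case: (size _) => // n; case: (size _) => // k; rewrite addnS.
Qed.

Lemma leaves2 V (t : term E V) : size (leaves t) = 2 ->
  exists e i j, t = Op e (Var i) (Var j).
Proof.
case: t => [//|e l r /=]; rewrite size_cat.
have := size_leaves_gt0 l; have := size_leaves_gt0 r.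
case El : (size (leaves l)) => [//|[|n]]; case Er : (size (leaves r)) => [//|[|k]] //;
  rewrite ?addnS //.
move=> _ _ _; have [i ->] := leaves1 El; have [j ->] := leaves1 Er.
by exists e, i, j.
Qed.

Lemma leaves3 V (t : term E V) : size (leaves t) = 3 ->
  exists f f' a b c, t = Op f (Op f' (Var a) (Var b)) (Var c)
    \/ t = Op f (Var c) (Op f' (Var a) (Var b)).
Proof.
case: t => [//|e l r /=]; rewrite size_cat.
have := size_leaves_gt0 l; have := size_leaves_gt0 r.
case El : (size (leaves l)) => [//|[|[|n]]];
  case Er : (size (leaves r)) => [//|[|[|k]]] //; rewrite ?addnS //.
  move=> _ _ _; have [c ->] := leaves1 El; have [f' [a [b ->]]] := leaves2 Er.
  by exists e, f', a, b, c; right.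
move=> _ _ _; have [c ->] := leaves1 Er; have [f' [a [b ->]]] := leaves2 El.
by exists e, f', a, b, c; left.
Qed.

End Trees.

Section NormalForm.
Variables (K : fieldType).
Local Notation E := (regular K).
Local Notation m := (mu K : s2space (regular K)).
Local Notation pre E V := {malg K[term (s2space E) V]}.
Variables (R : pre E 'I_3 -> Prop) (hR : forall r, R r -> arity (enum 'I_3) r).
Let Q := Quadratic hR.
Local Notation eqQ := (@eqmod K Q _).

(** Linearity in the operation, applied to -1 mu + mu. *)
Lemma eqmod_op0 (V : choiceType) (p q : pre E V) : eqQ (op (0 : gen Q) p q) 0.
Proof.
have := @eqmod_lin K Q V (-1) m m p q.
by rewrite scaleN1r addNr scaleN1r addNr.
Qed.

(** Everything can be written with mu alone, as mu and flip mu span E. *)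
Lemma eqmod_regular (V : choiceType) (e : E) (p q : pre E V) :
  eqQ (op e p q) (e.1 *: op m p q + e.2 *: op m q p).
Proof.
case: e => x y /=; have -> : (x, y) = x *: m + (y *: flip m + 0) :> K^o * K^o.
  by congr (_, _); rewrite /= scaler0 !addr0 ?add0r; apply/esym/mulr1.
apply: eqmod_trans (@eqmod_lin K Q V x m _ p q) _.
apply: eqmodD; first exact: eqmod_refl.
apply: eqmod_trans (@eqmod_lin K Q V y (flip m) 0 p q) _.
rewrite -[X in eqmod _ X]addr0; apply: eqmodD; last exact: eqmod_op0.
apply: eqmodZ; apply: eqmod_sym; apply: (@eqmod_flip K Q).
Qed.

Local Notation left_monomial := (@left_monomial K).
Local Notation right_monomial := (@right_monomial K).

Lemma eqmod_left_comb (e e' : E) (a b c : 'I_3) :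
  eqQ << Op e (Op e' (Var a) (Var b)) (Var c) >>
    (e.1 *: (e'.1 *: << left_monomial a b c >> + e'.2 *: << left_monomial b a c >>)
     + e.2 *: (e'.1 *: << right_monomial c a b >> + e'.2 *: << right_monomial c b a >>)).
Proof.
set A : pre E 'I_3 := << Var a >>; set B : pre E 'I_3 := << Var b >>.
set C : pre E 'I_3 := << Var c >>.
have -> : << Op e (Op e' (Var a) (Var b)) (Var c) >> = op e (op e' A B) C.
  by rewrite opU opU.
apply: eqmod_trans (eqmod_regular _ _ _) _.
have h := eqmod_regular e' A B.
apply: eqmodD; apply: eqmodZ.
  apply: eqmod_trans (@eqmod_op K Q _ m _ _ _ _ h (eqmod_refl _)) _.
  rewrite op_combl; have -> : << left_monomial a b c >> = op m (op m A B) C by rewrite 2!opU.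
  have -> : << left_monomial b a c >> = op m (op m B A) C by rewrite 2!opU.
  exact: eqmod_refl.
apply: eqmod_trans (@eqmod_op K Q _ m _ _ _ _ (eqmod_refl _) h) _.
rewrite op_combr; have -> : << right_monomial c a b >> = op m C (op m A B).
  exact: esym (etrans (congr1 (op m C) (opU m (Var a) (Var b))) (opU _ _ _)).
have -> : << right_monomial c b a >> = op m C (op m B A).
  exact: esym (etrans (congr1 (op m C) (opU m (Var b) (Var a))) (opU _ _ _)).
exact: eqmod_refl.
Qed.

(** A representative in the span of the twelve monomials, read off from the
pairings. *)
Definition normal_form (q : pre (s2dual E) 'I_3) : pre E 'I_3 :=
  coordinates (fun i j k => << left_monomial i j k >>) (fun i j k => << right_monomial i j k >>)
    (fun i j k => pairing q << left_monomial i j k >>) (fun i j k => pairing q << right_monomial i j k >>).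

Lemma normal_formP a q q' :
  normal_form (a *: q + q') = a *: normal_form q + normal_form q'.
Proof.
rewrite /normal_form -coordinatesP.
by apply: eq_coordinates => i j k; apply: pairingPl.
Qed.

Lemma pairing_left_comb (f f' : s2dual E) a b c i j k :
  let x := (undual f).1 in let y := (undual f).2 in
  let x' := (undual f').1 in let y' := (undual f').2 in
  let t := Op f (Op f' (Var a) (Var b)) (Var c) in
  (tree_pairing t (left_monomial i j k)
   = if (i, j, k) == (a, b, c) then sgn3 a b c * (x * x')
     else if (i, j, k) == (b, a, c) then sgn3 a b c * (x * - y') else 0) /\
  (tree_pairing t (right_monomial i j k)
   = if (j, k, i) == (a, b, c) then sgn3 a b c * (- y * x')
     else if (j, k, i) == (b, a, c) then sgn3 a b c * (- y * - y') else 0).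
Proof. by rewrite /tree_pairing /= !opprK. Qed.

Lemma eqmod_normal_form_left (f f' : s2dual E) (a b c : 'I_3) :
  uniq [:: a; b; c] ->
  let t := Op f (Op f' (Var a) (Var b)) (Var c) in
  eqQ (pre_map (@undual K) << t >>) (normal_form << t >>).
Proof.
move=> u t; rewrite pre_mapU /t /=.
apply: eqmod_trans (eqmod_left_comb _ _ _ _ _) _.
apply: (eq_ind_r (fun z => eqQ _ z) (eqmod_refl _)); apply/malgP => w.
pose phi (p : pre E 'I_3) := p@_w.
have hphi x p q : phi (x *: p + q) = x * phi p + phi q.
  by rewrite /phi mcoeffD mcoeffZ.
refine (etrans _ (coordinates_monomial hphi (fun i j k => << left_monomial i j k >>)
  (fun i j k => << right_monomial i j k >>) (undual f).1 (undual f).2 (undual f').1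
  (undual f').2 u)).
apply: (congr1 phi); apply: eq_coordinates => i j k.
  apply: etrans (pairingU _ _) _; exact: (pairing_left_comb f f' a b c i j k).1.
apply: etrans (pairingU _ _) _; exact: (pairing_left_comb f f' a b c i j k).2.
Qed.

Lemma eqmod_normal_form (q : pre (s2dual E) 'I_3) :
  arity (enum 'I_3) q -> eqQ (pre_map (@undual K) q) (normal_form q).
Proof.
move=> qA; rewrite (linear_monE q (pre_mapP (@undual K) (V:='I_3))).
rewrite (linear_monE q normal_formP).
apply: eqmod_sum_seq => t tq; apply: eqmodZ; move: (qA t tq) => {tq} tA.
have : size (leaves t) = 3 by rewrite (perm_size tA) size_enum_ord.
have tU : uniq (leaves t) by rewrite (perm_uniq tA) enum_uniq.
case/leaves3=> f [f' [a [b [c [et | et]]]]]; move: tU; rewrite et /= => tU.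
  exact: eqmod_normal_form_left.
have u : uniq [:: a; b; c] by rewrite (perm_uniq (permEl (perm_catC [:: a; b] [:: c]))).
have e : normal_form << Op (flip f) (Op f' (Var a) (Var b)) (Var c) >>
    = normal_form << Op f (Var c) (Op f' (Var a) (Var b)) >>.
  apply: eq_coordinates => i j k.
    by apply: etrans (pairingU _ _) _; apply: esym; apply: etrans (pairingU _ _) _.
  by apply: etrans (pairingU _ _) _; apply: esym; apply: etrans (pairingU _ _) _.
rewrite -{}e; apply: eqmod_trans (eqmod_normal_form_left (flip f) f' u).
apply: (eqmod_eq (pre_mapU _ _) (pre_mapU _ _)) => /=.
apply: (eqmod_eq erefl _ (@ideal_flip K Q _ (undual f) _ _)).
exact: (congr1 (fun e => << Op e _ _ >>) (undual_flip f)).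
Qed.

End NormalForm.

(** Evaluating a relator at three distinct letters is acting on it by a
permutation, so an annihilating element kills all these instances. *)
Lemma annihilates_generator (K : fieldType) (Q : @quadratic K)
   (q : {malg K[term (s2space (s2dual (gen Q))) 'I_3]}) r i j k :
  annihilator q -> relators r -> uniq [:: i; j; k] ->
  pairing q (subst (fun l => << Var (triple i j k l) >>) r) = 0.
Proof.
move=> [_ qr] rr u.
have inj : injective (triple i j k).
  move: u; rewrite /= !inE negb_or => /and3P [/andP[ij ik] jk _] x y.
  move: x y => [[|[|[|x]]] hx] [[|[|[|y]]] hy] //=; rewrite /triple /=;
   move=> e; apply: val_inj => //=; by move: ij ik jk; rewrite ?e ?eqxx.
rewrite -(qr _ (S3_act (perm inj) (S3_gen rr))); apply: (congr1 (pairing q)).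
by apply: eq_subst => l; rewrite permE.
Qed.

Section DualIdeals.
Variable K : fieldType.
Local Notation E := (regular K).
Local Notation m := (mu K : s2space (regular K)).
Local Notation pre E V := {malg K[term (s2space E) V]}.
Local Notation left_monomial := (@left_monomial K).
Local Notation right_monomial := (@right_monomial K).

Lemma pairing_commutator (q : pre (s2dual E) 'I_3) u v :
  pairing q (<< u >> - << v >> : pre E 'I_3) = 0 -> pairing q << u >> = pairing q << v >>.
Proof. by rewrite pairingBr => /eqP; rewrite subr_eq0 => /eqP. Qed.

Lemma pairing_associators (q : pre (s2dual E) 'I_3) u v u' v' :
  pairing q ((<< u >> - << v >>) - (<< u' >> - << v' >>) : pre E 'I_3) = 0 ->
  pairing q << u >> - pairing q << v >> = pairing q << u' >> - pairing q << v' >>.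
Proof.
rewrite pairingBr => /eqP; rewrite subr_eq0 => /eqP e.
by apply: etrans (esym (pairingBr _ _ _)) (etrans e (pairingBr _ _ _)).
Qed.

(** The orthogonality relations between coordinates are exactly the hypotheses of
[coordinates_right]. *)
Lemma left_annihilator_ideal (q : pre (s2dual E) 'I_3) :
  annihilator (Q := left_novikov K) q ->
  ideal (Q := right_novikov K) (pre_map (@undual K) q).
Proof.
move=> qann; apply: (eqmod_ideal (eqmod_normal_form _ qann.1)).
have qP i j k : uniq [:: i; j; k] ->
    pairing q << left_monomial i j k >> = pairing q << left_monomial i k j >>.
  move=> u; have := annihilates_generator qann (or_introl erefl) u.
  rewrite substB => h; apply: pairing_commutator; move: h.
  by congr (pairing q (_ - _) = 0); apply: subst_monomial.
have qM i j k : uniq [:: i; j; k] ->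
    pairing q << right_monomial i j k >> - pairing q << left_monomial i j k >> =
    pairing q << right_monomial j i k >> - pairing q << left_monomial j i k >>.
  move=> u; have := annihilates_generator qann (or_intror erefl) u.
  rewrite substB => h; apply: pairing_associators; move: h.
  by congr (pairing q (_ - _) = 0); apply: subst_associator.
have -> : normal_form q = \sum_(x <- even3) let: (i, j, k) := x in
    ((pairing q << left_monomial i j k >> - pairing q << right_monomial i j k >>) *:
       (<< right_monomial i j k >> - << right_monomial j i k >>)
     - pairing q << left_monomial i j k >> *:
       ((<< right_monomial i j k >> - << left_monomial i j k >>) - (<< right_monomial i k j >> - << left_monomial i k j >>))).
  apply/malgP => w; pose phi (p : pre E 'I_3) := p@_w.
  apply: (coordinates_right (phi := phi)) => // x p p'.
  by rewrite /phi mcoeffD mcoeffZ.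
apply: ideal_sum => -[[i j] k] _; apply: idealB; apply: idealZ.
  exact: right_novikov_lc.
exact: right_novikov_rs.
Qed.

Lemma right_annihilator_ideal (q : pre (s2dual E) 'I_3) :
  annihilator (Q := right_novikov K) q ->
  ideal (Q := left_novikov K) (pre_map (@undual K) q).
Proof.
move=> qann; apply: (eqmod_ideal (eqmod_normal_form _ qann.1)).
have qM i j k : uniq [:: i; j; k] ->
    pairing q << right_monomial i j k >> = pairing q << right_monomial j i k >>.
  move=> u; have := annihilates_generator qann (or_introl erefl) u.
  rewrite substB => h; apply: pairing_commutator; move: h.
  by congr (pairing q (_ - _) = 0); apply: subst_monomial.
have qP i j k : uniq [:: i; j; k] ->
    pairing q << right_monomial i j k >> - pairing q << left_monomial i j k >> =
    pairing q << right_monomial i k j >> - pairing q << left_monomial i k j >>.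
  move=> u; have := annihilates_generator qann (or_intror erefl) u.
  rewrite substB => h; apply: pairing_associators; move: h.
  by congr (pairing q (_ - _) = 0); apply: subst_associator.
have -> : normal_form q = \sum_(x <- even3) let: (i, j, k) := x in
    ((pairing q << left_monomial i j k >> - pairing q << right_monomial i j k >>) *:
       (<< left_monomial i j k >> - << left_monomial i k j >>)
     - pairing q << right_monomial i j k >> *:
       ((<< right_monomial i j k >> - << left_monomial i j k >>) - (<< right_monomial j i k >> - << left_monomial j i k >>))).
  apply/malgP => w; pose phi (p : pre E 'I_3) := p@_w.
  apply: (coordinates_left (phi := phi)) => // x p p'.
  by rewrite /phi mcoeffD mcoeffZ.
apply: ideal_sum => -[[i j] k] _; apply: idealB; apply: idealZ.
  exact: left_novikov_rc.
exact: left_novikov_ls.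
Qed.

End DualIdeals.

Lemma ideal_relations (K : fieldType) (P Q : @quadratic K)
    (g : {linear gen P -> gen Q}) r :
  (forall r, relators r -> ideal (pre_map g r)) ->
  relations (Q := P) r -> ideal (pre_map g r).
Proof.
move=> gR; elim=> {r} [r rr||a p q _ hp _ hq|s p _ hp].
- exact: gR.
- by rewrite pre_map0; apply: ideal0.
- by rewrite pre_mapP; apply: idealD => //; apply: idealZ.
by rewrite pre_map_relabel; apply: ideal_subst_term.
Qed.

Lemma relators_ideal (K : fieldType) (Q : @quadratic K) r :
  relators r -> ideal (Q := Q) r.
Proof.
move=> rr; have := ideal_rel (Q := Q) Var (S3_gen rr); by rewrite subst_id.
Qed.

(** It is enough to compare relations in both directions, since [undual] is an
isomorphism of S_2-modules sending the dual generator to mu. *)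
Lemma isomorphic_along_undual (K : fieldType) R R'
    (hR : forall r, R r -> arity (enum 'I_3) r)
    (hR' : forall r, R' r -> arity (enum 'I_3) r) :
  let P := @Quadratic K (regular K) R hR in
  let Q := @Quadratic K (regular K) R' hR' in
  (forall r, R' r -> annihilator (Q := P) (pre_map (@redual K) r)) ->
  (forall q, annihilator (Q := P) q -> ideal (Q := Q) (pre_map (@undual K) q)) ->
  isomorphic_along (P := quadratic_dual P) (Q := Q) (mu_dual K) (mu K).
Proof.
move=> P Q red und; exists (@pre_map K (gen (quadratic_dual P)) (gen Q) (@undual K) nat).
split.
  apply: (@operad_iso_pre_map K (quadratic_dual P) Q (@undual K) (@redual K)).
  - exact: undualK.
  - exact: redualK.
  - exact: undual_flip.
  - by move=> r; apply: ideal_relations => q; apply: und.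
  move=> r; apply: ideal_relations => q Rq.
  by apply: relators_ideal; apply: red.
apply: (eqmod_eq (pre_mapU _ _) erefl) => /=.
have -> : undual (mu_dual K) = mu K; last exact: eqmod_refl.
by rewrite /undual !mu_dualE /= oppr0.
Qed.

Theorem dual_left_novikov (K : fieldType) :
  isomorphic_along (P := quadratic_dual (left_novikov K))
    (Q := right_novikov K) (mu_dual K) (mu K).
Proof.
apply: isomorphic_along_undual => r; first exact: right_annihilates_left.
exact: left_annihilator_ideal.
Qed.

Theorem dual_right_novikov (K : fieldType) :
  isomorphic_along (P := quadratic_dual (right_novikov K))
    (Q := left_novikov K) (mu_dual K) (mu K).
Proof.
apply: isomorphic_along_undual => r; first exact: left_annihilates_right.
exact: right_annihilator_ideal.
Qed.

(** * Evaluation in a Novikov algebra *)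

Section Evaluation.
Variables (K : fieldType) (E : s2module K) (N : lmodType K).
Local Notation pre E V := {malg K[term (s2space E) V]}.
Variables (x : E -> K) (dot : N -> N -> N).
Hypothesis xP : forall a e f, x (a *: e + f) = a * x e + x f.
Hypothesis dotPl : forall a u u' v, dot (a *: u + u') v = a *: dot u v + dot u' v.
Hypothesis dotPr : forall a u v v', dot u (a *: v + v') = a *: dot u v + dot u v'.

(** An operation e = x(e) m + x(flip e) flip m acts on the algebra with product
[dot] as m acting by [dot]; [x] is the coordinate along m. *)
Definition act e u v := x e *: dot u v + x (flip e) *: dot v u.

Fixpoint term_eval (V : Type) (f : V -> N) (t : term E V) : N :=
  match t with
  | Var i => f i
  | Op e l r => act e (term_eval f l) (term_eval f r)
  end.

Definition eval (V : choiceType) (f : V -> N) : pre E V -> N := linext (term_eval f).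

Section OneAlphabet.
Variables (V : choiceType) (f : V -> N).

Lemma evalP a p q : eval f (a *: p + q) = a *: eval f p + eval f q.
Proof. exact: linext_is_linear. Qed.

Lemma eval0 : eval f 0 = 0.
Proof. exact: linear0 (linext (term_eval f)). Qed.

Lemma evalD p q : eval f (p + q) = eval f p + eval f q.
Proof. exact: linearD (linext (term_eval f)) _ _. Qed.

Lemma evalB p q : eval f (p - q) = eval f p - eval f q.
Proof. exact: linearB (linext (term_eval f)) _ _. Qed.

Lemma evalZ a p : eval f (a *: p) = a *: eval f p.
Proof. by rewrite -[a *: p]addr0 evalP eval0 addr0. Qed.

Lemma evalU t : eval f << t >> = term_eval f t.
Proof. exact: linextU. Qed.

Lemma actPl e a u u' v : act e (a *: u + u') v = a *: act e u v + act e u' v.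
Proof.
rewrite /act dotPl dotPr !scalerDr !scalerA !(mulrC a) addrACA.
by [].
Qed.

Lemma actPr e a u v v' : act e u (a *: v + v') = a *: act e u v + act e u v'.
Proof.
rewrite /act dotPl dotPr !scalerDr !scalerA !(mulrC a) addrACA.
by [].
Qed.

Lemma act0l e v : act e 0 v = 0.
Proof. by have := actPl e (-1) 0 0 v; rewrite scaler0 addr0 scaleN1r addNr. Qed.

Lemma act0r e u : act e u 0 = 0.
Proof. by have := actPr e (-1) u 0 0; rewrite scaler0 addr0 scaleN1r addNr. Qed.

Lemma eval_op e p q : eval f (op e p q) = act e (eval f p) (eval f q).
Proof.
move: p q; apply: eq_bilinear => [q a p p'|p a q q'|q a p p'|p a q q'|s t].
- by rewrite opPl evalP.
- by rewrite opPr evalP.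
- by rewrite evalP actPl.
- by rewrite evalP actPr.
by rewrite opU evalU evalU evalU.
Qed.

End OneAlphabet.

Lemma eval_subst (V W : choiceType) (f : W -> N) (g : V -> pre E W) p :
  eval f (subst g p) = eval (fun i => eval f (g i)) p.
Proof.
elim/pre_ind: p => [t||a p q hp hq].
- rewrite substU evalU; elim: t => [i|e l hl r hr] //=.
  by rewrite eval_op hl hr.
- by rewrite subst0 !eval0.
by rewrite substP 2!evalP; congr (_ *: _ + _).
Qed.

Lemma act_lin a e e' u v : act (a *: e + e') u v = a *: act e u v + act e' u v.
Proof.
by rewrite /act linearP /= !xP !scalerDl -!scalerA scalerDr addrACA.
Qed.

Lemma act_flip e u v : act (flip e) v u = act e u v.
Proof. by rewrite /act flipK addrC. Qed.

End Evaluation.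

Section EvaluationIdeal.
Variables (K : fieldType) (Q : @quadratic K) (N : lmodType K).
Local Notation pre E V := {malg K[term (s2space E) V]}.
Variables (x : gen Q -> K) (dot : N -> N -> N).
Hypothesis xP : forall a e f, x (a *: e + f) = a * x e + x f.
Hypothesis dotPl : forall a u u' v, dot (a *: u + u') v = a *: dot u v + dot u' v.
Hypothesis dotPr : forall a u v v', dot u (a *: v + v') = a *: dot u v + dot u v'.
Hypothesis relators0 : forall r (w : 'I_3 -> N), relators r -> eval x dot w r = 0.

Lemma eval_relations r (w : 'I_3 -> N) : relations r -> eval x dot w r = 0.
Proof.
move=> rr; elim: rr w => {r} [r rr||a p q _ hp _ hq|s p _ hp] w.
- exact: relators0.
- exact: eval0.
- by rewrite evalP hp hq scaler0 addr0.
rewrite /relabel eval_subst //; apply: hp.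
Qed.

(** An algebra satisfying the relations gives linear forms on P(n), whence on the
decorations of a tree. *)
Lemma eval_ideal (V : choiceType) (f : V -> N) (p : pre (gen Q) V) :
  ideal p -> eval x dot f p = 0.
Proof.
elim=> {p} [|p q _ hp _ hq|a p _ hp|a e e' s t|e s t|r h rr|e p q _ hp|e p q _ hq].
- exact: eval0.
- by rewrite evalD hp hq addr0.
- by rewrite evalZ hp scaler0.
- rewrite evalB evalP {1}evalU {1}evalU {1}evalU /= act_lin //; exact: subrr.
- by rewrite evalB {1}evalU {1}evalU /= act_flip subrr.
- by rewrite eval_subst // eval_relations.
- by rewrite eval_op // hp act0l.
by rewrite eval_op // hq act0r.
Qed.

End EvaluationIdeal.

(** * Differential polynomials of small weight *)

Ltac ring_in K := match goal with |- @eq _ ?l ?r => change (@eq K l r) end; ring.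

Section Model.
Variables (K : fieldType) (n : nat).
Local Notation E := (regular K).
Local Notation pre E V := {malg K[term (s2space E) V]}.

(** In order: x_i, x_i x_j', and x_i x_j' x_k' (flag [false]) or x_i x_j x_k''
(flag [true]).  These are coefficient functionals rather than monomials: the
indices j and k of x_i x_j' x_k', or i and j of x_i x_j x_k'', may be exchanged
without changing the functional on products. *)
Definition mono := ('I_n + 'I_n * 'I_n + bool * ('I_n * 'I_n * 'I_n))%type.
Definition W1 i : mono := inl (inl i).
Definition W2 i j : mono := inl (inr (i, j)).
Definition W3 i j k : mono := inr (false, (i, j, k)).
Definition W3'' i j k : mono := inr (true, (i, j, k)).

Definition model := {ffun mono -> K^o}.

(** The coefficients of u v', with the Leibniz rule applied to v.  Products of
weight four and more are dropped, which keeps an algebra satisfying the Novikov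
identities. *)
Definition dot_coef (u v : model) (z : mono) : K :=
  match z with
  | inl (inl _) => 0
  | inl (inr (i, j)) => u (W1 i) * v (W1 j)
  | inr (false, (i, j, k)) =>
      u (W2 i j) * v (W1 k) + u (W2 i k) * v (W1 j)
      + u (W1 i) * (v (W2 j k) + v (W2 k j))
  | inr (true, (i, j, k)) => u (W1 i) * v (W2 j k) + u (W1 j) * v (W2 i k)
  end.
Definition dot (u v : model) : model := [ffun z => dot_coef u v z].

Lemma dotPl a u u' v : dot (a *: u + u') v = a *: dot u v + dot u' v.
Proof.
apply/ffunP => -[[i|[i j]]|[[|] [[i j] k]]]; rewrite !ffunE /= ?ffunE /GRing.scale /=; ring_in K.
Qed.

Lemma dotPr a u v v' : dot u (a *: v + v') = a *: dot u v + dot u v'.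
Proof.
apply/ffunP => -[[i|[i j]]|[[|] [[i j] k]]]; rewrite !ffunE /= ?ffunE /GRing.scale /=; ring_in K.
Qed.

Lemma dot_rc u v w : dot (dot u v) w = dot (dot u w) v.
Proof.
apply/ffunP => -[[i|[i j]]|[[|] [[i j] k]]]; rewrite !ffunE /= ?ffunE /=; ring_in K.
Qed.

Lemma dot_ls u v w :
  dot u (dot v w) - dot (dot u v) w = dot v (dot u w) - dot (dot v u) w.
Proof.
apply/ffunP => -[[i|[i j]]|[[|] [[i j] k]]]; rewrite !ffunE /= ?ffunE /=; ring_in K.
Qed.

(** The variable x_i. *)
Definition gen1 i : model := [ffun z => (z == W1 i)%:R : K^o].

Lemma eval_associator (x : E -> K) (w : 'I_3 -> model) s t u :
  eval x dot w (associator s t u) =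
  term_eval x dot w (rassoc (mu K : s2space E) s t u)
  - term_eval x dot w (lassoc (mu K : s2space E) s t u).
Proof.
by apply: etrans (evalB _ _ _ _ _) _; congr (_ - _); apply: evalU.
Qed.

Lemma eval_left_relators r (w : 'I_3 -> model) : left_novikov_relators r ->
  eval (fun e : E => e.1) dot w r = 0.
Proof.
have m1 u v : act (fun e : E => e.1) dot (mu K) u v = dot u v.
  by rewrite /act /= scale1r scale0r addr0.
case=> ->; rewrite evalB.
  by rewrite {1}evalU {1}evalU /= !m1 dot_rc subrr.
apply: etrans (congr2 (fun p q => p - q) (eval_associator _ _ _ _ _)
  (eval_associator _ _ _ _ _)) _ => /=.
by rewrite !m1 dot_ls subrr.
Qed.

Lemma eval_right_relators r (w : 'I_3 -> model) : right_novikov_relators r ->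
  eval (fun e : E => e.2) dot w r = 0.
Proof.
have m1 u v : act (fun e : E => e.2) dot (mu K) u v = dot v u.
  by rewrite /act /= scale1r scale0r add0r.
case=> ->; rewrite evalB.
  by rewrite {1}evalU {1}evalU /= !m1 dot_rc subrr.
apply: etrans (congr2 (fun p q => p - q) (eval_associator _ _ _ _ _)
  (eval_associator _ _ _ _ _)) _ => /=.
rewrite !m1; set u := w _; set v := w _; set t := w _.
by rewrite -[X in X - _]opprB dot_ls opprB subrr.
Qed.

End Model.

Section Coefficients.
Variables (K : fieldType) (n : nat) (x : regular K -> K).
Local Notation E := (regular K).
Local Notation pre V := {malg K[term (s2space E) V]}.
Hypothesis xP : forall a e f, x (a *: e + f) = a * x e + x f.
Local Notation model := (model K n).
Local Notation dot := (@dot K n).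
Local Notation gen1 := (@gen1 K n).
Implicit Types (p : pre 'I_n) (z : mono n) (i j k : 'I_n).

(** The coefficient [z] of the operation [p] read as a differential polynomial. *)
Definition ev p z : K := eval x dot gen1 p z.

Lemma evP a p q z : ev (a *: p + q) z = a * ev p z + ev q z.
Proof. by rewrite /ev evalP !ffunE. Qed.

Lemma evE p z : ev p z = \sum_(t <- msupp p) p@_t * term_eval x dot gen1 t z.
Proof.
rewrite /ev /eval /linext sum_ffunE; apply: eq_bigr => t _.
by rewrite ffunE.
Qed.

Lemma gen1E i k : gen1 i (W1 k) = (i == k)%:R :> K.
Proof. by rewrite ffunE eq_sym. Qed.

Lemma gen1_W2 i j k : gen1 i (W2 j k) = 0.
Proof. by rewrite ffunE. Qed.

Lemma term_eval2_W1 (e : E) i j k :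
  term_eval x dot gen1 (Op e (Var i) (Var j)) (W1 k) = 0.
Proof. by rewrite /= /act !ffunE /= !scaler0 addr0. Qed.

Lemma term_eval2_W2 (e : E) i j k l :
  term_eval x dot gen1 (Op e (Var i) (Var j)) (W2 k l) =
  x e * ((i == k) && (j == l))%:R + x (flip e) * ((j == k) && (i == l))%:R.
Proof. by rewrite /= /act !ffunE /= !gen1E -!mulnb !natrM. Qed.

(** Elements of P(2) are spanned by trees of these two shapes, hence determined by
two coefficients. *)
Lemma binary_term i j (t : term E 'I_n) : perm_eq (leaves t) [:: i; j] ->
  exists e, t = Op e (Var i) (Var j) \/ t = Op e (Var j) (Var i).
Proof.
move=> tA; have /leaves2 [e [a [b et]]] : size (leaves t) = 2 by rewrite (perm_size tA).
move: tA; rewrite et /= => tA; exists e; rewrite -et.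
have := perm_mem tA a; rewrite !inE eqxx /= => /esym /orP [] /eqP ea.
  move: tA; rewrite ea perm_cons => /perm_mem /(_ b).
  by rewrite !inE eqxx => /esym /eqP eb; left; rewrite et ea eb.
move: tA; rewrite ea (perm_sym _ [:: i; j]) -[[:: i; j]]/([:: i] ++ [:: j]) perm_catC.
rewrite /= perm_cons => /perm_mem /(_ b).
by rewrite !inE eqxx => /eqP eb; right; rewrite et ea eb.
Qed.

Section Binary.
Variables (p : pre 'I_n) (i j : 'I_n).
Hypotheses (ij : i != j) (pA : arity [:: i; j] p).

Lemma ev_binary_W1 k : ev p (W1 k) = 0.
Proof.
rewrite evE big_seq big1 // => t /pA /binary_term [e [->|->]];
  by rewrite term_eval2_W1 mulr0.
Qed.

Lemma ev_binary_W2 k l : ev p (W2 k l) =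
  ev p (W2 i j) * ((i == k) && (j == l))%:R
  + ev p (W2 j i) * ((j == k) && (i == l))%:R.
Proof.
rewrite !evE !mulr_suml -big_split; apply: eq_big_seq => t /pA /binary_term [e et] /=.
have ji : j == i = false by rewrite eq_sym (negPf ij).
by case: et => ->; rewrite !term_eval2_W2 !eqxx (negPf ij) ji /=; ring.
Qed.

Lemma eval_binary (f : 'I_n -> model) : eval x dot f p =
  ev p (W2 i j) *: dot (f i) (f j) + ev p (W2 j i) *: dot (f j) (f i).
Proof.
rewrite !evE !scaler_suml -big_split /eval /linext /=.
apply: eq_big_seq => t /pA /binary_term [e et].
have ji : j == i = false by rewrite eq_sym (negPf ij).
case: et => ->; rewrite !term_eval2_W2 !eqxx (negPf ij) ji /= /act;
  rewrite !(mulr0, mulr1, addr0, add0r) scalerDr !scalerA //; exact: addrC.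
Qed.

End Binary.

(** The Leibniz rule for a composite of two binary operations: each cubic
coefficient of the composite is a sum of products of quadratic ones. *)
Lemma ev_subst p q (f : 'I_n -> pre 'I_n) i j (k l : 'I_n) :
  i != j -> arity [:: i; j] p -> f i = q -> f j = << Var j >> ->
  k != l -> arity [:: k; l] q ->
  (forall a b c, ev (subst f p) (W3 a b c) =
     ev p (W2 i c) * ev q (W2 a b) + ev p (W2 i b) * ev q (W2 a c)
     + (ev p (W2 a i) * ev q (W2 b c) + ev p (W2 a i) * ev q (W2 c b))) /\
  (forall a b c, ev (subst f p) (W3'' a b c) =
     ev p (W2 a i) * ev q (W2 b c) + ev p (W2 b i) * ev q (W2 a c)).
Proof.
move=> ij pA fi fj kl qA.
have es : eval x dot gen1 (subst f p) = ev p (W2 i j) *: dot (eval x dot gen1 q) (gen1 j)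
    + ev p (W2 j i) *: dot (gen1 j) (eval x dot gen1 q).
  rewrite eval_subst //; [|exact: dotPl|exact: dotPr].
  by rewrite (eval_binary ij pA) fi fj !evalU.
have q1 a : eval x dot gen1 q (W1 a) = 0 := ev_binary_W1 qA a.
have pW a b := ev_binary_W2 ij pA a b.
have ji : j == i = false by rewrite eq_sym (negPf ij).
split=> a b c; rewrite {1}/ev es !ffunE /= !q1 !gen1E !gen1_W2 -!/(ev q _) /GRing.scale /=.
  rewrite (pW i c) (pW i b) (pW a i) !eqxx ji /= !andbF !andbT.
  by move: (_ == c) (_ == b) (_ == a) => [] [] [] /=; ring_in K.
rewrite (pW a i) (pW b i) !eqxx ji /= !andbT !andbF.
by move: (_ == a) (_ == b) => [] [] /=; ring_in K.
Qed.

End Coefficients.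

(** * The table of the cocycle *)

Notation i0 := (@Ordinal 5 0 isT).
Notation i1 := (@Ordinal 5 1 isT).
Notation i2 := (@Ordinal 5 2 isT).
Notation i3 := (@Ordinal 5 3 isT).
Notation i4 := (@Ordinal 5 4 isT).

(** Leaf sets are computed with as increasing lists of leaves. *)
Notation code := (seq 'I_5).
Definition top : code := [:: i0; i1; i2; i3; i4].

Fixpoint sublists (T : Type) k (s : seq T) : seq (seq T) :=
  match k, s with
  | 0, _ => [:: [::]]
  | k'.+1, a :: s' => map (cons a) (sublists k' s') ++ sublists k s'
  | _, [::] => [::]
  end.

(** The possible leaf sets of the vertices other than the root, by increasing size
and then lexicographically; this order is used to list the edges of a tree. *)
Definition codes : seq code := sublists 2 top ++ sublists 3 top ++ sublists 4 top.

(** Signed sums of coefficients, [true] standing for the sign -1. *)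
Notation form := (seq (bool * mono 5)).

(** A summand of the cocycle at the tree with non-root vertices [low] and [high]:
a sign and the coefficient to be taken at each of the three vertices. *)
Record row := Row {
  low : code; high : code; neg : bool;
  root_mono : mono 5; low_mono : mono 5; high_mono : mono 5
}.

Definition expand_row s A B (f g h : form) : seq row :=
  [seq Row A B (s (+) q.1.1.1 (+) q.1.2.1 (+) q.2.1) q.1.1.2 q.1.2.2 q.2.2
  | q <- [seq (p, c) | p <- [seq (a, b) | a <- f, b <- g], c <- h]].

(** The tensor factors of the cocycle are few: single coefficients, [comm] and
[skew], which are antisymmetric in their last two indices, and the three-term
form [kappa]. *)
Definition pure (z : mono 5) : form := [:: (false, z)].
Definition bin i j : form := pure (W2 i j).
Definition comm i j : form := [:: (false, W2 i j); (true, W2 j i)].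
Definition kappa i j k : form :=
  [:: (false, W3'' i j k); (true, W3 i j k); (false, W3'' i k j)].
Definition skew i j k : form := [:: (false, W3'' i j k); (true, W3'' i k j)].

(** Each line is a product of three forms, at the root, at the first and at the
second vertex.  The table is a sparse solution of the linear system expressing
closedness, normalized so that a single line, with leaf sets 13 and 0123, meets
the pentagon. *)
Definition table : seq row := flatten [::
  expand_row false [:: i0; i2] [:: i1; i4] (kappa i0 i1 i3) (bin i0 i2) (bin i1 i4);
  expand_row true [:: i0; i2] [:: i0; i1; i2] (kappa i0 i3 i4) (bin i0 i2) (bin i1 i0);
  expand_row true [:: i0; i2] [:: i0; i2; i3] (kappa i1 i0 i4) (bin i0 i2) (bin i0 i3);
  expand_row false [:: i0; i2] [:: i0; i1; i2; i3] (comm i0 i4) (bin i0 i2) (pure (W3 i1 i0 i3));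
  expand_row true [:: i0; i2] [:: i0; i1; i2; i4] (comm i0 i3) (bin i0 i2) (kappa i1 i0 i4);
  expand_row false [:: i0; i4] [:: i1; i2] (kappa i1 i0 i3) (bin i0 i4) (bin i1 i2);
  expand_row false [:: i0; i4] [:: i2; i3] (kappa i1 i0 i2) (bin i0 i4) (bin i2 i3);
  expand_row true [:: i0; i4] [:: i0; i1; i4] (kappa i2 i0 i3) (bin i0 i4) (bin i1 i0);
  expand_row false [:: i1; i2] [:: i1; i2; i3] (kappa i0 i1 i4) (bin i1 i2) (bin i1 i3);
  expand_row false [:: i1; i2] [:: i0; i1; i2; i4] (comm i0 i3) (bin i1 i2) (skew i0 i1 i4);
  expand_row false [:: i1; i3] [:: i0; i1; i2; i3] (comm i0 i4) (bin i1 i3) (pure (W3'' i0 i1 i2));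
  expand_row false [:: i1; i4] [:: i0; i1; i2; i4] (comm i0 i3) (bin i1 i4) (skew i0 i1 i2);
  expand_row false [:: i2; i3] [:: i1; i2; i3] (kappa i0 i1 i4) (bin i2 i3) (bin i1 i2);
  expand_row false [:: i2; i3] [:: i0; i1; i2; i3] (comm i0 i4) (bin i3 i2) (pure (W3'' i0 i1 i2));
  expand_row true [:: i0; i1; i2] [:: i0; i1; i2; i4] (comm i0 i3) (pure (W3'' i0 i1 i2)) (bin i4 i0);
  expand_row true [:: i0; i1; i4] [:: i0; i1; i2; i4] (comm i0 i3) (pure (W3'' i0 i1 i4)) (bin i2 i0);
  expand_row false [:: i0; i2; i3] [:: i0; i1; i2; i3] (comm i0 i4) (pure (W3'' i0 i3 i2)) (bin i1 i0);
  expand_row false [:: i1; i2; i3] [:: i0; i1; i2; i3] (comm i0 i4) (pure (W3 i1 i2 i3)) (bin i0 i1);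
  expand_row true [:: i1; i2; i4] [:: i0; i1; i2; i4] (comm i0 i3) (kappa i1 i2 i4) (bin i0 i1)
].

(* The combinatorics of trees on leaf sets given by lists. *)
Definition subc (a b : code) := all (mem b) a.
Definition psubc a b := subc a b && ~~ subc b a.
Definition compat a b := [|| subc a b, subc b a | ~~ has (mem b) a].
Definition minc (e : code) (i : 'I_5) := (i \in e) && all (fun j : 'I_5 => (i <= j)%N) e.
Definition inputc (fl : seq code) c :=
  [seq i <- c | all (fun e => psubc e c && (i \in e) ==> minc e i) fl].
Definition parentc fl c e :=
  [&& e \in fl, psubc c e & all (fun e' => psubc c e' ==> subc e e') fl].
Definition firstc (e : code) := head i0 e.

Definition mono_at r e :=
  if e == low r then low_mono r else if e == high r then high_mono r else root_mono r.

Notation pair5 := ('I_5 * 'I_5)%type.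

(* A tree with four vertices on five leaves is binary, and contracting an edge
   produces exactly one ternary vertex: the coefficient taken there has weight
   three, the two others have weight two. *)
Definition is_binary (z : mono 5) := if z is inl (inr _) then true else false.
Definition is_ternary (z : mono 5) := if z is inr _ then true else false.
Definition binary_pair (z : mono 5) : pair5 := if z is inl (inr p) then p else (i0, i0).

(** The terms of [ev_subst]: the coefficient [z] of a composite at the input [i] is
the sum, over the listed pairs, of the product of a coefficient of the outer
operation by one of the inner operation. *)
Definition leibniz (z : mono 5) (i : 'I_5) : seq (pair5 * pair5) :=
  match z with
  | inr (false, (a, b, c)) =>
      [:: ((i, c), (a, b)); ((i, b), (a, c)); ((a, i), (b, c)); ((a, i), (c, b))]
  | inr (true, (a, b, c)) => [:: ((a, i), (b, c)); ((b, i), (a, c))]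
  | _ => [::]
  end.

Definition rows_at y z := [seq r <- table | (low r == y) && (high r == z)].
Definition parent_of fl x y z := head top [seq e <- [:: top; y; z] | parentc fl x e].

(** The coefficients at the four binary vertices [fl] resulting from a row [r]:
the ternary vertex [D] splits into [D] and the contracted vertex [x] along the
pair [q]. *)
Definition key_of fl x D r (q : pair5 * pair5) : seq pair5 :=
  [seq if e == D then q.1 else if e == x then q.2 else binary_pair (mono_at r e)
  | e <- fl].

Definition contraction_terms fl s x y z : seq (bool * seq pair5) :=
  let D := parent_of fl x y z in
  [seq (s (+) neg rq.1, key_of fl x D rq.1 rq.2)
  | rq <- [seq (r, q) | r <- rows_at y z, q <- leibniz (mono_at r D) (firstc x)]].

(** The facts about the contraction of [x] in a binary tree on which the expansion
of the cocycle relies; they are verified tree by tree. *)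
Definition contractible fl x y z :=
  let D := parent_of fl x y z in let i := firstc x in
  [&& D \in [:: top; y; z], parentc fl x D,
      all (fun e => (e != D) ==> ~~ parentc fl x e) [:: top; y; z],
      minc x i, size (inputc fl D) == 2, i \in inputc fl D, size (inputc fl x) == 2,
      perm_eq fl (D :: x :: rem D [:: top; y; z]) &
      all (fun r => is_ternary (mono_at r D) &&
        all (fun e => (e != D) ==> is_binary (mono_at r e)) [:: top; y; z]) (rows_at y z)].

(** An operation in P(2) with inputs i and j has no other coefficients than those
of x_i x_j' and x_j x_i'. *)
Definition orders (s : code) : seq pair5 :=
  if s is [:: i; j] then [:: (i, j); (j, i)] else [::].

Fixpoint keys (fl : seq code) (s : seq code) : seq (seq pair5) :=
  if s is e :: s' then [seq p :: k | p <- orders (inputc fl e), k <- keys fl s'] else [:: [::]].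

(** The differential of the cocycle at the binary tree with non-root vertices a, b,
c, taken in the order of [codes], hence with alternating signs. *)
Definition tree_terms a b c :=
  let fl := [:: top; a; b; c] in
  contraction_terms fl false a b c ++ contraction_terms fl true b a c
    ++ contraction_terms fl false c a b.

(** The expansion vanishes because every product of coefficients that can be nonzero
occurs equally often with either sign. *)
Definition check_tree a b c :=
  let fl := [:: top; a; b; c] in
  let ts := tree_terms a b c in
  [&& uniq fl, all (fun e => size (inputc fl e) == 2) fl, contractible fl a b c, contractible fl b a c, contractible fl c a b &
      all (fun k => count (fun l => l.1 && (l.2 == k)) ts
                    == count (fun l => ~~ l.1 && (l.2 == k)) ts) (keys fl fl)].

(* Three leaf sets form a tree only if they are pairwise nested or disjoint. *)
Definition check_list l :=
  if l is [:: a; b; c] then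
    if [&& compat a b, compat a c & compat b c] then check_tree a b c else true
  else true.

Lemma check_trees : all check_list (sublists 3 codes).
Proof. by vm_compute. Qed.

(** * Trees on five leaves as lists of leaf sets *)

Lemma mem_sublists (T : eqType) k (s l : seq T) :
  subseq l s -> size l = k -> l \in sublists k s.
Proof.
elim: s k l => [|a s IH] [|k] [|b l] //= sub; rewrite ?inE //.
case=> sl; rewrite mem_cat; move: sub; case: eqP => [->|_] sub.
  by rewrite map_f // IH.
by rewrite (IH k.+1 (b :: l)) ?orbT //= sl.
Qed.

Definition set_of (c : code) : {set 'I_5} := [set i in c].

Lemma mem_set_of c i : (i \in set_of c) = (i \in c).
Proof. by rewrite inE. Qed.

Lemma subset_set_of a b : (set_of a \subset set_of b) = subc a b.
Proof.
apply/subsetP/allP => h i; last by rewrite !mem_set_of; apply: h.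
by move=> ia; have := h i; rewrite !mem_set_of; apply.
Qed.

Lemma proper_set_of a b : (set_of a \proper set_of b) = psubc a b.
Proof. by rewrite properE !subset_set_of. Qed.

Lemma disjoint_set_of a b : [disjoint set_of a & set_of b] = ~~ has (mem b) a.
Proof.
rewrite -setI_eq0; apply/eqP/hasPn => [ab i ia|ab].
  apply/negP => ib; have : i \in set_of a :&: set_of b by rewrite inE !mem_set_of ia.
  by rewrite ab inE.
apply/setP => i; rewrite inE !mem_set_of inE; apply/negP => /andP [ia].
exact/negP/ab.
Qed.

Lemma is_min_set_of e i : is_min (set_of e) i = minc e i.
Proof.
rewrite /is_min /minc mem_set_of; congr (_ && _).
apply/forall_inP/allP => h j je; apply: h; first by rewrite mem_set_of.
by rewrite mem_set_of in je.
Qed.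

Lemma mem_top i : i \in top.
Proof. by case: i => [[|[|[|[|[|i]]]]] hi]. Qed.

Lemma set_of_top : set_of top = [set: 'I_5].
Proof. by apply/setP => i; rewrite mem_set_of mem_top inE. Qed.

Lemma set_of_inj : {in top :: codes &, injective set_of}.
Proof.
move=> a b ha hb eab.
have /allP/(_ a ha)/allP/(_ b hb)/implyP h : all (fun a => all (fun b =>
  subc a b && subc b a ==> (a == b)) (top :: codes)) (top :: codes).
  by vm_compute.
by apply/eqP/h; rewrite -!subset_set_of eab subxx.
Qed.

(** Every possible vertex other than the root is listed in [codes]. *)
Lemma set_of_onto (C : {set 'I_5}) : (1 < #|C|)%N -> C != setT ->
  exists2 c, c \in codes & C = set_of c.
Proof.
move=> C1 CT; pose c := [seq i <- top | i \in C].
have eC : C = set_of c.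
  by apply/setP => i; rewrite mem_set_of mem_filter mem_top andbT.
exists c => //; move: C1 CT.
have -> : #|C| = size c.
  rewrite {1}eC cardsE; apply/card_uniqP; apply: filter_uniq; by vm_compute.
have -> : (C != setT) = (c != top).
  apply/idP/idP; apply: contraNN => /eqP; last first.
    by move=> CT; rewrite /c CT; apply/eqP/all_filterP/allP => i _; rewrite inE.
  by move=> ct; rewrite eC ct set_of_top.
rewrite /c /top /=.
by case: (i0 \in C); case: (i1 \in C); case: (i2 \in C); case: (i3 \in C);
  case: (i4 \in C); vm_compute.
Qed.

(* The set-theoretic notions of trees agree with the computable ones. *)
Section Reflection.
Variables (F : {set {set 'I_5}}) (fl : seq code).
Hypothesis hF : F =i [seq set_of e | e <- fl].

Lemma forall_in_tree (P : {set 'I_5} -> bool) :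
  [forall D in F, P D] = all (fun e => P (set_of e)) fl.
Proof.
apply/forall_inP/allP => h; first by move=> e ef; apply: h; rewrite hF map_f.
by move=> D; rewrite hF => /mapP [e ef ->]; apply: h.
Qed.

Lemma inputs_set_of c : inputs F (set_of c) =i inputc fl c.
Proof.
move=> i; rewrite inE mem_set_of mem_filter [RHS]andbC; congr (_ && _).
rewrite forall_in_tree; apply: eq_all => e /=.
by rewrite proper_set_of mem_set_of is_min_set_of.
Qed.

Lemma is_parent_set_of c e : e \in fl ->
  is_parent F (set_of c) (set_of e) = parentc fl c e.
Proof.
move=> ef; rewrite /is_parent hF map_f // /parentc ef proper_set_of; congr (_ && _).
rewrite forall_in_tree; congr (_ && _); apply: eq_all => e' /=.
by rewrite proper_set_of subset_set_of.
Qed.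

End Reflection.

Definition codes_of (F : {set {set 'I_5}}) := [seq c <- codes | set_of c \in F].

Lemma uniq_codes : uniq (top :: codes).
Proof. by vm_compute. Qed.

Lemma codes_uniq : uniq codes.
Proof. by vm_compute. Qed.

Lemma top_notin_codes : top \notin codes.
Proof. by vm_compute. Qed.

Lemma uniq_codes_of F : uniq (top :: codes_of F).
Proof.
have /andP [tc cu] := uniq_codes.
by rewrite /= filter_uniq // andbT mem_filter negb_and tc orbT.
Qed.

Lemma codes_of_sub F : {subset top :: codes_of F <= top :: codes}.
Proof.
move=> c; rewrite 2!in_cons => /orP [->|] //; rewrite mem_filter => /andP [_ ->].
by rewrite orbT.
Qed.

Lemma mem_codes_of F : is_tree F -> F =i [seq set_of e | e <- top :: codes_of F].
Proof.
case=> FT F1 _ C; rewrite /= inE set_of_top.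
have [->|CT] /= := eqVneq C setT; first by [].
apply/idP/mapP => [CF|[c]]; last by rewrite mem_filter => /andP [cF _] ->.
have [c cc eC] := set_of_onto (F1 C CF) CT.
by exists c => //; rewrite mem_filter -eC CF.
Qed.

Lemma card_tree F : is_tree F -> #|F| = (size (codes_of F)).+1.
Proof.
move=> Ft; rewrite (eq_card (mem_codes_of Ft)).
transitivity (size [seq set_of e | e <- top :: codes_of F]); last by rewrite size_map.
apply/card_uniqP.
rewrite map_inj_in_uniq ?uniq_codes_of // => a b /codes_of_sub ha /codes_of_sub hb.
exact: set_of_inj.
Qed.

Lemma compat_tree F a b : is_tree F -> a \in codes_of F -> b \in codes_of F -> compat a b.
Proof.
move=> [_ _ Fl]; rewrite !mem_filter => /andP [aF _] /andP [bF _].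
rewrite /compat -!subset_set_of -disjoint_set_of.
by case: (Fl _ _ aF bF) => ->; rewrite ?orbT.
Qed.

Lemma codes_of_rem F c : c \in codes -> codes_of (F :\ set_of c) = rem c (codes_of F).
Proof.
move=> cc; rewrite rem_filter; last by have /andP [] := uniq_codes_of F.
rewrite -filter_predI; apply: eq_in_filter => e ec /=; rewrite !inE.
congr (~~ _ && _); apply/eqP/eqP => [|-> //].
by apply: set_of_inj; rewrite in_cons ?ec ?cc orbT.
Qed.

(** * The cocycle *)

Lemma signed_sum0 (K : comPzRingType) (T : eqType) (ts : seq (bool * T)) (ks : seq T)
    (m : T -> K) :
  (forall l, l \in ts -> l.2 \notin ks -> m l.2 = 0) ->
  {in ks, forall k, count (fun l => l.1 && (l.2 == k)) ts
                    = count (fun l => ~~ l.1 && (l.2 == k)) ts} ->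
  \sum_(l <- ts) (-1) ^+ l.1 * m l.2 = 0.
Proof.
move=> m0 cnt.
transitivity (\sum_(l <- ts) \sum_(k <- undup ks) (-1) ^+ l.1 * m k *+ (l.2 == k)).
  apply: eq_big_seq => l lt; have [lk|lk] := boolP (l.2 \in ks).
    rewrite (bigD1_seq l.2) ?mem_undup ?undup_uniq //= eqxx mulr1n.
    rewrite big1 ?addr0 // => k /negPf kl.
    by rewrite eq_sym kl mulr0n.
  rewrite m0 // mulr0 big_seq big1 // => k; rewrite mem_undup => kk.
  by case: eqP lk => [->|//]; rewrite kk.
rewrite exchange_big big_seq big1 //= => k; rewrite mem_undup => /cnt {m0}cnt.
transitivity (m k *+ count (fun l => ~~ l.1 && (l.2 == k)) ts
              - m k *+ count (fun l => l.1 && (l.2 == k)) ts); last by rewrite cnt subrr.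
elim: ts {cnt} => [|[s t] ts IH] /=; first by rewrite big_nil subr0.
rewrite big_cons IH /= !mulrnDr; case: s; case: (t == k) => /=;
  rewrite ?mulr1n ?mulr0n ?expr1 ?expr0 ?mulN1r ?mul1r ?add0r //.
  by rewrite opprD addrCA.
by rewrite addrA.
Qed.

Lemma sum3 (V : nmodType) (T : Type) (a b c : T) (G : T -> V) :
  \sum_(e <- [:: a; b; c]) G e = G a + (G b + G c).
Proof. by rewrite !big_cons big_nil addr0. Qed.

Section Cocycle.
Variable K : fieldType.
Local Notation E := (regular K).
Local Notation pre V := {malg K[term (s2space E) V]}.
Variables (R : pre 'I_3 -> Prop) (hR : forall r, R r -> arity (enum 'I_3) r).
Let Q := Quadratic hR.
Variable x : E -> K.
Hypothesis xP : forall a e f, x (a *: e + f) = a * x e + x f.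
Hypothesis xR : forall r w, R r -> eval x (@dot K 5) w r = 0.
Local Notation ev := (@ev K 5 x).
Local Notation decoration := ({set 'I_5} -> pre 'I_5).
Local Notation contract := (@contract K Q 5).
Implicit Type d : decoration.

Lemma arity_perm (A B : seq 'I_5) (p : pre 'I_5) : perm_eq A B -> arity A p -> arity B p.
Proof. by move=> AB pA t /pA tA; apply: perm_trans AB. Qed.

(** A product of one linear form per vertex, hence multilinear in the decoration. *)
Definition row_value r d : K :=
  (-1) ^+ neg r * \prod_(e <- [:: top; low r; high r]) ev (d (set_of e)) (mono_at r e).

Definition Phi y z d : K := \sum_(r <- rows_at y z) row_value r d.

Definition rank_of (c : code) : nat := enum_rank (set_of c).

(** Cochains are trivialized with respect to the order of the leaf sets in the
enumeration of all subsets, the table with respect to [codes]; this is the sign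
of the permutation comparing them. *)
Definition orient y z : K := (-1) ^+ (rank_of z < rank_of y)%N.

Definition phi : family Q 5 := fun F d =>
  if codes_of F is [:: y; z] then orient y z * Phi y z d else 0.

(** The coefficients are well defined on P because differential polynomials form a
Novikov algebra. *)
Lemma ev_ideal (p : pre 'I_5) z : ideal (Q := Q) p -> ev p z = 0.
Proof.
move=> pI; rewrite /ev (eval_ideal (Q := Q) xP (@dotPl K 5) (@dotPr K 5) xR _ pI).
by rewrite ffunE.
Qed.

Lemma tree3 F : is_tree F -> #|F| = 3 -> exists y z, codes_of F = [:: y; z].
Proof.
move=> Ft; rewrite card_tree //; case: (codes_of F) => [|y [|z [|]]] // _.
by exists y, z.
Qed.

(** Each row is a product over the vertices of linear forms that vanish on the
ideal. *)
Lemma cochain_phi : cochain 3 phi.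
Proof.
move=> F Ft F3; have [y [z eF]] := tree3 Ft F3; rewrite /phi eF.
have hF := mem_codes_of Ft; rewrite eF in hF.
have uF := uniq_codes_of F; rewrite eF in uF.
have inj : {in [:: top; y; z] &, injective set_of}.
  move=> a b ha hb; apply: set_of_inj; apply: (@codes_of_sub F); by rewrite eF.
split=> [C a d d1 d2 CF _ _ _ dC dD|C d CF _ dI]; last first.
  rewrite /Phi /rows_at big_filter big1 ?mulr0 // => r /andP [/eqP ry /eqP rz].
  move: CF; rewrite hF => /mapP [e ee eC].
  rewrite /row_value ry rz (bigD1_seq e) //= -eC ev_ideal //.
  by rewrite mul0r mulr0.
rewrite mulrCA -mulrDr; congr (_ * _); rewrite /Phi /rows_at !big_filter.
rewrite mulr_sumr -big_split; apply: eq_bigr => r /andP [/eqP ry /eqP rz] /=.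
rewrite /row_value ry rz mulrCA -mulrDr; congr (_ * _).
move: CF; rewrite hF => /mapP [e ee eC].
rewrite !(bigD1_seq e ee uF) /= -eC dC evP // mulrDl mulrA.
have eq12 (d' : decoration) : (forall D, D \in F -> D != C -> d' D = d D) ->
   \prod_(i <- [:: top; y; z] | i != e) ev (d (set_of i)) (mono_at r i) =
   \prod_(i <- [:: top; y; z] | i != e) ev (d' (set_of i)) (mono_at r i).
  move=> dd'; rewrite big_seq_cond [RHS]big_seq_cond; apply: eq_bigr => i /andP [ii ie].
  rewrite dd' ?hF ?map_f //; apply: contraNN ie; rewrite eC => /eqP ei.
  by rewrite (inj _ _ ii ee ei).
congr (_ * _ + _ * _); apply: eq12 => D DF DC.
  by have [] := dD D DF DC.
by have [] := dD D DF DC.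
Qed.

Lemma perm_edges F : is_tree F ->
  perm_eq [seq C <- index_enum {set 'I_5} | (C \in F) && (C != setT)]
          [seq set_of e | e <- codes_of F].
Proof.
move=> Ft; have hF := mem_codes_of Ft; have /andP [topn uF] := uniq_codes_of F.
have inj : {in top :: codes_of F &, injective set_of}.
  by move=> a b /codes_of_sub ha /codes_of_sub hb; apply: set_of_inj.
apply: uniq_perm; first by rewrite filter_uniq // index_enum_uniq.
  rewrite map_inj_in_uniq // => a b ha hb; apply: inj; by rewrite in_cons ?ha ?hb orbT.
move=> C; rewrite mem_filter mem_index_enum andbT hF /= in_cons set_of_top.
apply/andP/mapP => [[/orP [/eqP ->|/mapP []]]|[e ee ->]]; rewrite ?eqxx //.
  by move=> e ee eC _; exists e.
split; first by rewrite map_f ?orbT.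
rewrite -set_of_top; apply: contraNneq topn => eT.
by rewrite -(inj e top) ?in_cons ?ee ?eqxx ?orbT.
Qed.

Lemma sum_edges F (G : {set 'I_5} -> K) : is_tree F ->
  \sum_(C in F | C != setT) G C = \sum_(e <- codes_of F) G (set_of e).
Proof. by move=> Ft; rewrite -big_filter (perm_big _ (perm_edges Ft)) big_map. Qed.

(** Signs depend only on comparisons between edges, so they can be evaluated without
computing the enumeration of all subsets. *)
Lemma edge_rank_codes F e : is_tree F ->
  edge_rank F (set_of e) = (\sum_(e' <- codes_of F) (rank_of e' < rank_of e))%N.
Proof.
move=> Ft; rewrite /edge_rank -sum1_card (eq_bigl (fun D => (D \in F) && (D != setT) &&
  (enum_rank D < enum_rank (set_of e))%N)); last by move=> D; rewrite !inE andbA.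
rewrite big_mkcondr -big_filter (perm_big _ (perm_edges Ft)) big_map /=.
by apply: eq_bigr => e' _; rewrite /rank_of; case: (_ < _)%N.
Qed.

Lemma rank_of_inj : {in top :: codes &, injective rank_of}.
Proof.
move=> a b ha hb /val_inj /enum_rank_inj; exact: set_of_inj.
Qed.

Section Contraction.
Variables (F : {set {set 'I_5}}) (fl : seq code) (d : decoration).
Hypotheses (hF : F =i [seq set_of e | e <- fl]) (dF : decorates (Q := Q) F d).

Definition key_value (k : seq pair5) : K :=
  \prod_(p <- zip fl k) ev (d (set_of p.1)) (W2 p.2.1 p.2.2).

Lemma arity_inputc e i j : e \in fl -> inputc fl e =i [:: i; j] -> i != j ->
  arity [:: i; j] (d (set_of e)).
Proof.
move=> ef eij ij; have ar := dF (C := set_of e); apply: arity_perm (ar _); last first.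
  by rewrite hF map_f.
apply: uniq_perm; rewrite ?enum_uniq //= ?inE ?andbT // => k.
by rewrite mem_enum (inputs_set_of hF) eij.
Qed.

Lemma inputc_pair e : uniq e -> size (inputc fl e) == 2 ->
  exists i j, inputc fl e = [:: i; j] /\ i != j.
Proof.
move=> eU; have := filter_uniq (fun i => all (fun e' => psubc e' e && (i \in e')
   ==> minc e' i) fl) eU; rewrite -/(inputc fl e).
case: (inputc fl e) => [|i [|j [|]]] //=; rewrite inE andbT => ij _.
by exists i, j.
Qed.

Lemma key_value_map (f : code -> pair5) :
  key_value (map f fl) = \prod_(e <- fl) ev (d (set_of e)) (W2 (f e).1 (f e).2).
Proof.
rewrite /key_value -[X in zip X _]map_id zip_map big_map.
by [].
Qed.

Lemma ev_contract c e w : e \in fl -> ~~ parentc fl c e ->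
  ev (contract F (set_of c) d (set_of e)) w = ev (d (set_of e)) w.
Proof. by move=> ef /negPf np; rewrite /Defs.contract (is_parent_set_of hF c ef) np. Qed.

(** The parent of the contracted vertex carries a composite, to which the Leibniz
rule applies. *)
Lemma ev_contract_parent c e w : {in fl, forall e, uniq e} ->
  c \in fl -> e \in fl -> parentc fl c e -> minc c (firstc c) ->
  size (inputc fl e) == 2 -> firstc c \in inputc fl e -> size (inputc fl c) == 2 ->
  is_ternary w ->
  ev (contract F (set_of c) d (set_of e)) w =
  \sum_(q <- leibniz w (firstc c))
     ev (d (set_of e)) (W2 q.1.1 q.1.2) * ev (d (set_of c)) (W2 q.2.1 q.2.2).
Proof.
move=> fU cf ef ce cmin e2 ie c2 w3.
rewrite /Defs.contract (is_parent_set_of hF c ef) ce.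
have [k [l [ekl kl]]] := inputc_pair (fU c cf) c2.
have cA : arity [:: k; l] (d (set_of c)).
  by apply: arity_inputc => // u; rewrite ekl.
have [j [ij eA]] : exists j, firstc c != j /\ arity [:: firstc c; j] (d (set_of e)).
  have [a [b [eab ab]]] := inputc_pair (fU e ef) e2.
  move: ie; rewrite eab !inE => /orP [] /eqP ->; [exists b | exists a].
    by split=> //; apply: arity_inputc => // u; rewrite eab.
  rewrite eq_sym; split=> //; apply: arity_inputc => // [u|]; last by rewrite eq_sym.
  by rewrite eab !inE orbC.
have minU u : minc c u -> u = firstc c.
  move=> /andP [uc /allP ule]; case/andP: cmin => fc /allP fle.
  by apply/val_inj/eqP; rewrite eqn_leq ule // fle.
pose f i := if is_min (set_of c) i then d (set_of c) else xvar (gen Q) i.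
have fi : f (firstc c) = d (set_of c) by rewrite /f is_min_set_of cmin.
have fj : f j = << Var j >>.
  rewrite /f is_min_set_of; case: ifP => // /minU jc; by rewrite jc eqxx in ij.
have [h3 h3''] := @ev_subst K 5 x _ _ f _ _ _ _ ij eA fi fj kl cA.
case: w w3 => // -[[] [[a b] t]] _.
  by apply: etrans (h3'' a b t) _; rewrite /= !big_cons big_nil addr0.
by apply: etrans (h3 a b t) _; rewrite /= !big_cons big_nil addr0 !addrA.
Qed.

Lemma row_contract c y z r : uniq fl -> {in fl, forall e, uniq e} ->
  c \in fl -> {subset [:: top; y; z] <= fl} -> contractible fl c y z -> low r = y -> high r = z ->
  let D := parent_of fl c y z in
  is_ternary (mono_at r D) ->
  all (fun e => (e != D) ==> is_binary (mono_at r e)) [:: top; y; z] ->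
  row_value r (contract F (set_of c) d) =
  \sum_(q <- leibniz (mono_at r D) (firstc c)) (-1) ^+ neg r * key_value (key_of fl c D r q).
Proof.
move=> flU fU cf sub; rewrite /contractible; set D := parent_of _ _ _ _.
case/and5P => DT cD /allP nD cmin /and5P [D2 iD c2 pfl _] ry rz D3 /allP r2.
rewrite /row_value ry rz -mulr_sumr; congr (_ * _).
have := flU; rewrite (perm_uniq pfl) => /and3P []; rewrite !inE negb_or => /andP [Dc Drem] crem remU.
rewrite (perm_big _ (perm_to_rem DT)) big_cons (ev_contract_parent fU) // ?sub //.
set rest := (X in _ _ X = _); rewrite -[LHS]/((\sum_(q <- _) _) * rest) mulr_suml.
apply: eq_bigr => q _; rewrite {}/rest.
rewrite /key_of key_value_map (perm_big _ pfl) 2!big_cons eqxx.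
rewrite (negPf (_ : c != D)) 1?eq_sym // eqxx.
rewrite -mulrA; congr (_ * (_ * _)).
apply: eq_big_seq => e er; have eT : e \in [:: top; y; z] := mem_rem er.
have eD : e != D by apply: contraNneq Drem => eqD; rewrite -[X in X \in _]eqD.
have ec : e != c by apply: contraNneq crem => eqc; rewrite -[X in X \in _]eqc.
rewrite (negPf eD) (negPf ec) ev_contract ?sub //; last by apply: (implyP (nD e eT)).
by have := implyP (r2 e eT) eD; case: (mono_at r e) => [[|[a b]]|].
Qed.

Lemma Phi_contract c y z (s : bool) : uniq fl -> {in fl, forall e, uniq e} ->
  c \in fl -> {subset [:: top; y; z] <= fl} -> contractible fl c y z ->
  (-1) ^+ s * Phi y z (contract F (set_of c) d) =
  \sum_(l <- contraction_terms fl s c y z) (-1) ^+ l.1 * key_value l.2.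
Proof.
move=> flU fU cf sub ct.
rewrite /contraction_terms big_map big_allpairs_dep /Phi mulr_sumr.
have /and5P [_ _ _ _ /and5P [_ _ _ _ rowsP]] := ct.
rewrite -(all_filterP rowsP) /rows_at -filter_predI !big_filter.
apply: eq_bigr => r /and3P [/andP [r3 r2] /eqP ry /eqP rz].
rewrite (row_contract flU fU cf sub ct ry rz r3 r2) mulr_sumr.
by apply: eq_bigr => q _ /=; rewrite signr_addb mulrA.
Qed.

Lemma orders_value e p : e \in fl -> uniq e -> size (inputc fl e) == 2 ->
  p \notin orders (inputc fl e) -> ev (d (set_of e)) (W2 p.1 p.2) = 0.
Proof.
move=> ef eU e2; have [i [j [eij ij]]] := inputc_pair eU e2.
have eA : arity [:: i; j] (d (set_of e)) by apply: arity_inputc => // u; rewrite eij.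
case: p => k l; rewrite eij /= !inE !xpair_eqE negb_or => /andP [/negPf pij /negPf pji].
rewrite (ev_binary_W2 x ij eA).
by rewrite (eq_sym i k) (eq_sym j l) pij (eq_sym j k) (eq_sym i l) pji !mulr0 addr0.
Qed.

(** Keys outside the verified list name a coefficient that vanishes at some
vertex. *)
Lemma key_value0 k : {in fl, forall e, uniq e} ->
  {in fl, forall e, size (inputc fl e) == 2} ->
  size k = size fl -> k \notin keys fl fl -> key_value k = 0.
Proof.
move=> fU f2; rewrite /key_value; have : {subset fl <= fl} by [].
move: {1 3 5 6}fl k => s; elim: s => [|e s IH] [|p k] //= sub [sz] kn.
rewrite big_cons /=; have ef : e \in fl by apply: sub; rewrite mem_head.
have [po|pn] := boolP (p \in orders (inputc fl e)); last first.
  by rewrite (orders_value ef (fU e ef) (f2 e ef) pn) mul0r.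
rewrite IH ?mulr0 // => [i is_|]; first by apply: sub; rewrite in_cons is_ orbT.
by apply: contra kn => kk; apply/allpairsP; exists (p, k).
Qed.

End Contraction.

Lemma size_contraction_terms fl s c y z l : l \in contraction_terms fl s c y z ->
  size l.2 = size fl.
Proof.
move: l; suff /allP h : all (fun l => size l.2 == size fl) (contraction_terms fl s c y z).
  by move=> l /h /eqP.
by rewrite all_map; apply/all_filterP; rewrite (eq_filter (a2 := predT)) ?filter_predT // => rq;
  rewrite /= size_map eqxx.
Qed.

(** The differential at a binary tree is, up to the global sign of the comparison
of orders, the alternating sum over its three edges that [check_trees] shows to
vanish. *)
Lemma cocycle_phi : eq_cochain (Q := Q) 4 (differential phi) (fun _ _ => 0).
Proof.
move=> F d Ft F4 dF; have hF := mem_codes_of Ft.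
have : size (codes_of F) = 3 by apply: succn_inj; rewrite -card_tree.
case eF : (codes_of F) => [|a [|b [|c [|]]]] // _.
have := allP check_trees [:: a; b; c].
rewrite -eF mem_sublists ?filter_subseq ?eF // => /(_ isT) /=.
have sub e : e \in [:: a; b; c] -> e \in codes_of F by rewrite eF.
rewrite !(compat_tree Ft) ?sub ?inE ?eqxx ?orbT //= => /and5P [flU /allP f2 ca cb /andP [cc /allP cnt]].
set fl := [:: top; a; b; c] in hF flU f2 ca cb cc cnt *.
have {}hF : F =i [seq set_of e | e <- fl] by move=> C; rewrite hF eF.
have fU : {in fl, forall e, uniq e}.
  have cU : all uniq (top :: codes) by vm_compute.
  by move=> e ef; apply: (allP cU); apply: (@codes_of_sub F); rewrite eF.
have subfl y z : y \in fl -> z \in fl -> {subset [:: top; y; z] <= fl}.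
  by move=> yf zf e; rewrite !in_cons orbF => /or3P [] /eqP -> //; rewrite mem_head.
have [af bf cf] : [/\ a \in fl, b \in fl & c \in fl] by rewrite /fl !in_cons !eqxx !orbT.
have := flU; rewrite /fl /= !in_cons !negb_or !in_nil /= !andbT.
case/and3P => _ /andP [ab ac] bc.
have incodes e : e \in [:: a; b; c] -> e \in codes.
  by rewrite -eF mem_filter => /andP [].
have [aC bC cC] : [/\ a \in codes, b \in codes & c \in codes].
  by split; apply: incodes; rewrite !in_cons eqxx ?orbT.
pose X s e y z := (-1) ^+ s * Phi y z (contract F (set_of e) d).
have phi_at e y z : rem e [:: a; b; c] = [:: y; z] -> e \in codes ->
    phi (F :\ set_of e) (contract F (set_of e) d) = orient y z * X false e y z.
  by move=> re eC; rewrite /phi codes_of_rem // eF re /X mul1r.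
have sum0 : X false a b c + (X true b a c + X false c a b) = 0.
  have ha := Phi_contract hF dF false flU fU af (subfl b c bf cf) ca.
  have hb := Phi_contract hF dF true flU fU bf (subfl a c af cf) cb.
  have hc := Phi_contract hF dF false flU fU cf (subfl a b af bf) cc.
  apply: etrans (congr2 +%R ha (congr2 +%R hb hc)) _.
  rewrite -2!big_cat; apply: (@signed_sum0 _ _ (tree_terms a b c) (keys fl fl)) => [l lt kn|k kk].
    apply: (key_value0 hF dF) => //; move: lt; rewrite !mem_cat => /or3P [] /size_contraction_terms //.
  by apply/eqP/cnt.
have rk e e' : e \in codes -> e' \in codes -> e != e' ->
    (rank_of e < rank_of e')%N = ~~ (rank_of e' < rank_of e)%N.
  move=> ec ec' ee'; rewrite -leqNgt [RHS]leq_eqVlt; case: eqP => // eq_rk; case/eqP: ee'.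
  by apply: rank_of_inj eq_rk; rewrite in_cons ?ec ?ec' orbT.
have ea : edge_rank F (set_of a) = ((rank_of b < rank_of a) + (rank_of c < rank_of a))%N.
  by rewrite edge_rank_codes // eF !big_cons big_nil ltnn addn0.
have eb : edge_rank F (set_of b) = (~~ (rank_of b < rank_of a) + (rank_of c < rank_of b))%N.
  by rewrite edge_rank_codes // eF !big_cons big_nil ltnn addn0 -rk.
have ec : edge_rank F (set_of c) = (~~ (rank_of c < rank_of a) + ~~ (rank_of c < rank_of b))%N.
  by rewrite edge_rank_codes // eF !big_cons big_nil ltnn !addn0 -!rk.
have pa : phi (F :\ set_of a) (contract F (set_of a) d) = orient b c * X false a b c.
  by apply: phi_at => //; rewrite /= eqxx.
have pb : phi (F :\ set_of b) (contract F (set_of b) d) = orient a c * - X true b a c.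
  have Xb : X false b a c = - X true b a c by rewrite /X expr1 mulN1r opprK mul1r.
  apply: etrans (phi_at b a c _ bC) (congr1 ( *%R _) Xb).
  by rewrite /= (negPf ab) eqxx.
have pc : phi (F :\ set_of c) (contract F (set_of c) d) = orient a b * X false c a b.
  by apply: phi_at => //; rewrite /= (negPf ac) (negPf bc) eqxx.
pose term n v : K := (-1) ^+ n * v.
rewrite /differential sum_edges // eF; apply: etrans (sum3 _ _ _ _) _.
apply: etrans (congr2 +%R (congr2 term ea pa)
  (congr2 +%R (congr2 term eb pb) (congr2 term ec pc))) _.
rewrite /term /orient; move: (rank_of b < rank_of a)%N (rank_of c < rank_of a)%N (rank_of c < rank_of b)%N.
move: sum0; move: {ea eb ec pa pb pc phi_at}(X false a b c) (X true b a c) (X false c a b) => u v w uvw.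
have -> : u = - (v + w) by apply/eqP; rewrite -addr_eq0 uvw.
by case; case; case; rewrite /= ?addn0 ?add0n; ring.
Qed.

End Cocycle.

(** * Coboundaries on trees with three vertices *)

Section TreeSets.

Definition tree_set (l : seq code) : {set {set 'I_5}} :=
  [set C | C \in [seq set_of e | e <- top :: l]].

Definition treec (l : seq code) := subseq l codes && all (fun a => all (compat a) l) l.

Lemma mem_tree_set l : tree_set l =i [seq set_of e | e <- top :: l].
Proof. by move=> C; rewrite inE. Qed.

Lemma codes_card c : c \in codes -> (1 < #|set_of c|)%N.
Proof.
move=> cc; have /allP/(_ c cc) /andP [uc sc] : all (fun c => uniq c && (1 < size c)%N) codes.
  by vm_compute.
by rewrite cardsE (card_uniqP uc).
Qed.

Lemma is_tree_set l : treec l -> is_tree (tree_set l).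
Proof.
case/andP => /mem_subseq sub /allP lam; split.
- by rewrite mem_tree_set /= set_of_top mem_head.
- move=> C; rewrite mem_tree_set => /mapP [e]; rewrite in_cons => /orP [/eqP -> ->|/sub ec ->].
    by rewrite set_of_top cardsT card_ord.
  exact: codes_card.
move=> C D; rewrite !mem_tree_set => /mapP [a aF ->] /mapP [b bF ->].
move: aF bF; rewrite !in_cons.
case/orP => [/eqP -> _|al]; first by constructor 2; rewrite set_of_top subsetT.
case/orP => [/eqP ->|bl]; first by constructor 1; rewrite set_of_top subsetT.
have /allP/(_ b bl) := lam a al.
by rewrite /compat -!subset_set_of -disjoint_set_of => /or3P [] h;
  [constructor 1 | constructor 2 | constructor 3].
Qed.

Lemma codes_of_tree_set l : treec l -> codes_of (tree_set l) = l.
Proof.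
case/andP => sub _; have topn := top_notin_codes.
rewrite {2}(elimT (subseq_uniqP codes_uniq) sub).
apply: eq_in_filter => c cc; rewrite mem_tree_set.
apply/mapP/idP => [[e el ec]|cl]; last by exists c => //; rewrite in_cons cl orbT.
have ce : c = e.
  apply: set_of_inj ec; rewrite in_cons ?cc ?orbT //.
  move: el; rewrite in_cons => /orP [->|el] //.
  by rewrite (mem_subseq sub el) orbT.
move: el; rewrite -ce in_cons => /orP [/eqP ct|//].
by rewrite ct (negPf topn) in cc.
Qed.

Lemma card_tree_set l : treec l -> #|tree_set l| = (size l).+1.
Proof. by move=> tl; rewrite card_tree ?codes_of_tree_set //; apply: is_tree_set. Qed.

End TreeSets.

Section Obstruction.
Variable K : fieldType.
Local Notation E := (regular K).
Local Notation pre V := {malg K[term (s2space E) V]}.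
Variables (R : pre 'I_3 -> Prop) (hR : forall r, R r -> arity (enum 'I_3) r).
Let Q := Quadratic hR.
Local Notation contract := (@contract K Q 5).
Local Notation decoration := ({set 'I_5} -> pre 'I_5).
Local Notation eqQ := (@eqmod K Q _).
Implicit Types (d : decoration) (p q r : pre 'I_5).

Lemma decorates_tree_set l d :
  (forall e, e \in top :: l -> uniq e /\ arity (inputc (top :: l) e) (d (set_of e))) ->
  decorates (Q := Q) (tree_set l) d.
Proof.
move=> h C; rewrite mem_tree_set => /mapP [e ef ->]; have [eU eA] := h e ef.
apply: arity_perm eA; apply: uniq_perm; rewrite ?enum_uniq ?filter_uniq // => i.
by rewrite mem_enum (inputs_set_of (@mem_tree_set l)).
Qed.

Section Coboundary.
Variable psi : family Q 5.
Hypothesis psi2 : cochain 2 psi.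

(** A cochain depends on the decoration of a vertex only modulo the ideal: apply
linearity to the difference. *)
Lemma two_vertex_congr F C d d' : is_tree F -> #|F| = 2 -> C \in F ->
  decorates (Q := Q) F d -> decorates (Q := Q) F d' ->
  (forall D, D \in F -> D != C -> d D = d' D) -> eqQ (d C) (d' C) -> psi F d = psi F d'.
Proof.
move=> Ft F2 CF dF d'F dd' e; have [lin van] := psi2 Ft F2.
pose d2 D := if D == C then d C - d' C else d D.
have d2F : decorates (Q := Q) F d2.
  move=> D DF; rewrite /d2; case: eqP => [->|_]; last exact: dF.
  by apply: arityB; [apply: dF | apply: d'F].
rewrite (lin C 1 d d' d2 CF dF d'F d2F).
- by rewrite mul1r (van C d2) ?addr0 // /d2 eqxx.
- by rewrite /d2 eqxx scale1r addrC subrK.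
by move=> D DF DC; rewrite /d2 (negPf DC) dd'.
Qed.

(** Decorations of the trees with one or two vertices beside the root; [r] sits at
the root. *)
Definition deco1 e r q : decoration := fun C => if C == set_of e then q else r.
Definition deco2 y p z q r : decoration := fun C =>
  if C == set_of y then p else if C == set_of z then q else r.
Definition psi_value e r q := psi (tree_set [:: e]) (deco1 e r q).

(** The composite that a contraction puts at the parent of [c]: the input of [r]
named by the least leaf of [c] is replaced by [p]. *)
Definition plug (c : code) p r : pre 'I_5 :=
  subst (fun i => if minc c i then p else xvar E i) r.

Lemma set_of_top_neq e : e \in codes -> (set_of top == set_of e) = false.
Proof.
move=> ec; apply/negP => /eqP te; have et : top = e.
  by apply: set_of_inj te; rewrite ?mem_head // in_cons ec orbT.
by have := top_notin_codes; rewrite et ec.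
Qed.

Definition decorates1 e r q :=
  arity (inputc [:: top; e] top) r /\ arity (inputc [:: top; e] e) q.

Lemma decorates_deco1 e r q : e \in codes -> decorates1 e r q ->
  decorates (Q := Q) (tree_set [:: e]) (deco1 e r q).
Proof.
move=> ec [rA qA]; have cU : all uniq (top :: codes) by vm_compute.
apply: decorates_tree_set => e'; rewrite /deco1 !in_cons orbF => /orP [] /eqP ->.
  split; first by vm_compute.
  by rewrite set_of_top_neq.
by split; [apply: (allP cU); rewrite in_cons ec orbT | rewrite eqxx].
Qed.

Lemma treec1 e : e \in codes -> treec [:: e].
Proof.
move=> ec; rewrite /treec sub1seq ec /= /compat /subc.
by have -> : all (mem e) e by apply/allP.
Qed.

Lemma psi_value_root e r r' q : e \in codes -> decorates1 e r q -> decorates1 e r' q ->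
  eqQ r r' -> psi_value e r q = psi_value e r' q.
Proof.
move=> ec h h' rr'; have te := treec1 ec.
have topE := set_of_top_neq ec.
apply: (@two_vertex_congr _ (set_of top)).
- exact: is_tree_set.
- by rewrite card_tree_set.
- by rewrite mem_tree_set map_f ?mem_head.
- exact: decorates_deco1.
- exact: decorates_deco1.
- move=> D; rewrite mem_tree_set /= !in_cons orbF => /orP [] /eqP ->; rewrite ?eqxx //.
  by rewrite /deco1 eqxx.
by rewrite /deco1 topE.
Qed.

Lemma psi_value_edge e r q q' : e \in codes -> decorates1 e r q -> decorates1 e r q' ->
  eqQ q q' -> psi_value e r q = psi_value e r q'.
Proof.
move=> ec h h' qq'; have te := treec1 ec.
apply: (@two_vertex_congr _ (set_of e)).
- exact: is_tree_set.
- by rewrite card_tree_set.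
- by rewrite mem_tree_set map_f // in_cons mem_head orbT.
- exact: decorates_deco1.
- exact: decorates_deco1.
- by move=> D _ De; rewrite /deco1 (negPf De).
by rewrite /deco1 eqxx.
Qed.

Lemma contract_codes (F : {set {set 'I_5}}) fl c e d :
  F =i [seq set_of a | a <- fl] -> e \in fl ->
  contract F (set_of c) d (set_of e) =
  if parentc fl c e then plug c (d (set_of c)) (d (set_of e)) else d (set_of e).
Proof.
move=> hF ef; rewrite /Defs.contract (is_parent_set_of hF c ef); case: (parentc fl c e); last by [].
by apply: eq_subst => i; rewrite is_min_set_of.
Qed.

(** The value of psi on the contraction of [c] depends only on what the two
remaining vertices carry. *)
Lemma psi_contract l c e d r q : treec l -> perm_eq l [:: c; e] ->
  (if parentc (top :: l) c top then plug c (d (set_of c)) (d (set_of top))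
   else d (set_of top)) = r ->
  (if parentc (top :: l) c e then plug c (d (set_of c)) (d (set_of e))
   else d (set_of e)) = q ->
  decorates1 e r q ->
  psi (tree_set l :\ set_of c) (contract (tree_set l) (set_of c) d) = psi_value e r q.
Proof.
move=> tl lce er eq rqA; have hF := @mem_tree_set l.
have sub a : a \in l -> a \in codes by have /andP [/mem_subseq h _] := tl; apply: h.
have [cl el] : c \in l /\ e \in l by rewrite !(perm_mem lce) !inE !eqxx orbT.
have ce : c != e.
  have := codes_uniq; have /andP [/subseq_uniq h _] := tl; move/h.
  by rewrite (perm_uniq lce) /= inE andbT.
have ec := sub _ el; have cc := sub _ cl.
have nce : (set_of e == set_of c) = false.
  apply/negP => /eqP /set_of_inj ece; move: ce; rewrite ece ?eqxx // in_cons ?ec ?cc orbT //.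
have -> : tree_set l :\ set_of c = tree_set [:: e].
  apply/setP => C; rewrite in_setD1 !mem_tree_set /= !in_cons.
  rewrite (perm_mem (perm_map set_of lce)) /= !in_cons in_nil !orbF.
  case: eqVneq => [->|_] /=; last by [].
  by rewrite [set_of c == set_of top]eq_sym set_of_top_neq // [set_of c == _]eq_sym nce.
have vt : contract (tree_set l) (set_of c) d (set_of top) = r.
  by rewrite (contract_codes c d hF) ?mem_head.
have ve : contract (tree_set l) (set_of c) d (set_of e) = q.
  by rewrite (contract_codes c d hF) // in_cons el orbT.
have [rA qA] := rqA; have cU : all uniq (top :: codes) by vm_compute.
apply: (@two_vertex_congr _ (set_of top)).
- by apply: is_tree_set; apply: treec1.
- by rewrite card_tree_set //; apply: treec1.
- by rewrite mem_tree_set map_f ?mem_head.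
- apply: decorates_tree_set => e'; rewrite !in_cons orbF => /orP [] /eqP ->.
    by rewrite vt; split; first by vm_compute.
  by rewrite ve; split; first by apply: (allP cU); rewrite in_cons ec orbT.
- exact: decorates_deco1.
- move=> D; rewrite mem_tree_set /= !in_cons orbF => /orP [] /eqP ->; rewrite ?eqxx //.
  by rewrite ve /deco1 eqxx.
rewrite vt /deco1 set_of_top_neq //; exact: eqmod_refl.
Qed.

Variable x : E -> K.
Hypothesis dpsi : eq_cochain (Q := Q) 3 (differential psi) (phi x).

(** A coboundary at a tree with two edges is the difference of the two contractions;
the sign of the enumeration cancels against [orient]. *)
Lemma Phi_coboundary y z d ry qy rz qz : treec [:: y; z] ->
  decorates (Q := Q) (tree_set [:: y; z]) d ->
  psi (tree_set [:: y; z] :\ set_of y) (contract (tree_set [:: y; z]) (set_of y) d)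
    = psi_value z rz qz ->
  psi (tree_set [:: y; z] :\ set_of z) (contract (tree_set [:: y; z]) (set_of z) d)
    = psi_value y ry qy ->
  Phi x y z d = psi_value z rz qz - psi_value y ry qy.
Proof.
move=> tl dF ey ez; set F := tree_set _ in dF ey ez; have Ft : is_tree F := is_tree_set tl.
have eF : codes_of F = [:: y; z] := codes_of_tree_set tl.
have yz : (rank_of y < rank_of z)%N = ~~ (rank_of z < rank_of y)%N.
  have [cy cz] : y \in codes /\ z \in codes.
    by have /andP [/mem_subseq h _] := tl; rewrite !h ?inE ?eqxx ?orbT.
  have nyz : y != z.
    have := codes_uniq; have /andP [/subseq_uniq h _] := tl; move/h.
    by rewrite /= inE andbT.
  rewrite -leqNgt [RHS]leq_eqVlt; case: eqP => // eq_rk; case/eqP: nyz.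
  by apply: rank_of_inj eq_rk; rewrite in_cons ?cy ?cz orbT.
have := dpsi Ft (card_tree_set tl) dF; rewrite /phi eF /differential sum_edges // eF.
rewrite !big_cons big_nil /=.
have -> : edge_rank F (set_of y) = (rank_of z < rank_of y)%N.
  by rewrite edge_rank_codes // eF !big_cons big_nil ltnn addn0.
have -> : edge_rank F (set_of z) = ~~ (rank_of z < rank_of y)%N.
  by rewrite edge_rank_codes // eF !big_cons big_nil ltnn !addn0 -yz.
move=> h; move: (etrans (congr2 (fun u v => _ * u + (_ * v + 0)) (esym ey) (esym ez)) h).
rewrite /orient; case: (_ < _)%N => /=.
  rewrite expr1 expr0 mul1r addr0 !mulN1r => e; apply: oppr_inj; rewrite -e.
  by rewrite opprB addrC.
by rewrite expr1 expr0 !mul1r addr0 !mulN1r => <-.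
Qed.

End Coboundary.
End Obstruction.

(** * Associators and right multiplications *)

Section ArityOp.
Variables (K : fieldType) (E : s2module K) (V : choiceType).
Local Notation pre := {malg K[term (s2space E) V]}.

Lemma arity_monomial (A : seq V) (t : term E V) :
  perm_eq (leaves t) A -> arity A (<< t >> : pre).
Proof. by move=> tA u; rewrite msuppU oner_eq0 inE => /eqP ->. Qed.

Lemma arity_op (A B : seq V) (e : E) (p q : pre) :
  arity A p -> arity B q -> arity (A ++ B) (op e p q).
Proof.
move=> pA qB t; rewrite -mcoeff_neq0 /op raddf_sum /=.
have [|no] := boolP (has (fun s => has (fun u => Op e s u == t) (msupp q)) (msupp p)).
  by case/hasP => s sp /hasP [u uq /eqP <-] _; apply: perm_cat; [apply: pA | apply: qB].
rewrite big_seq big1 ?eqxx // => s sp; rewrite raddf_sum big_seq big1 // => u uq.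
rewrite /= mcoeffZ mcoeffU; have /hasPn /(_ u uq) /negPf -> := hasPn no s sp.
by rewrite mulr0n mulr0.
Qed.

(** The associator of linear combinations, [assoc] being that of trees. *)
Definition passoc (e : E) (p q r : pre) : pre := op e p (op e q r) - op e (op e p q) r.

Lemma arity_passoc (A B C : seq V) (e : E) (p q r : pre) :
  arity A p -> arity B q -> arity C r -> arity (A ++ B ++ C) (passoc e p q r).
Proof.
move=> pA qB rC t /(fsubsetP (msuppB_le _ _)); rewrite in_fsetU => /orP [].
  by apply: arity_op => //; apply: arity_op.
by rewrite catA; apply: arity_op => //; apply: arity_op.
Qed.

End ArityOp.

Section Identities.
Variable K : fieldType.
Local Notation E := (regular K).
Local Notation pre V := {malg K[term (s2space E) V]}.
Variables (R : pre 'I_3 -> Prop) (hR : forall r, R r -> arity (enum 'I_3) r).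
Let Q := Quadratic hR.
Variable V : choiceType.
Local Notation eqQ := (@eqmod K Q V).
Variable m : s2space E.
Hypothesis rc : forall s t u : term E V, eqQ << lassoc m s t u >> << lassoc m s u t >>.
Hypothesis ls : forall s t u : term E V, eqQ (assoc m s t u) (assoc m t s u).
Implicit Types s t u w : term E V.

Lemma eqmod_rc s t u :
  eqQ (op m (op m << s >> << t >>) << u >>) (op m (op m << s >> << u >>) << t >>).
Proof.
apply: eqmod_eq (rc s t u); apply: etrans (congr1 (opl m _) (opU _ _ _)) (opU _ _ _).
Qed.

Lemma passocU s t u : passoc m << s >> << t >> << u >> = assoc m s t u :> pre V.
Proof.
apply: (congr2 (fun a b => a - b)).
  exact: etrans (congr1 (op m _) (opU _ _ _)) (opU _ _ _).
exact: etrans (congr1 (opl m _) (opU _ _ _)) (opU _ _ _).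
Qed.

(** Right-commutativity moves a factor on the right of a product into its left
argument, so it passes through both terms of the associator. *)
Lemma assoc_mulr s t u w :
  eqQ (op m (assoc m s t u) << w >>) (assoc m (Op m s w) t u).
Proof.
have e : op m (assoc m s t u) << w >> =
    << Op m (rassoc m s t u) w >> - << Op m (lassoc m s t u) w >> :> pre V.
  apply: etrans (linearB (opl m << w >>) _ _) _.
  by apply: (congr2 (fun a b => a - b)); apply: opU.
apply: (@eqmod_eq K Q V _ _ _ _ e erefl); apply: eqmodB.
  exact: rc s (Op m t u) w.
apply: eqmod_trans (rc (Op m s t) u w) _.
have h := @eqmod_op K Q V m _ _ _ _ (rc s t w) (@eqmod_refl K Q V << u >>).
by apply: (@eqmod_eq K Q V _ _ _ _ _ _ h); apply/esym/opU.
Qed.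

(** Left-symmetry exchanges the first two slots, so [assoc_mulr] also moves the
factor into the second one. *)
Lemma passoc_shift s t u w :
  eqQ (passoc m (op m << s >> << w >>) << t >> << u >>)
      (passoc m << s >> (op m << t >> << w >>) << u >>).
Proof.
apply: (@eqmod_eq K Q V _ (assoc m (Op m s w) t u) _ (assoc m s (Op m t w) u)).
- exact: etrans (congr1 (fun p => passoc m p << t >> << u >>) (opU m s w))
    (passocU (Op m s w) t u).
- exact: etrans (congr1 (fun p => passoc m << s >> p << u >>) (opU m t w))
    (passocU s (Op m t w) u).
apply: eqmod_trans (eqmod_sym (assoc_mulr s t u w)) _.
apply: eqmod_trans (@eqmod_op K Q V m _ _ _ _ (ls s t u) (@eqmod_refl K Q V << w >>)) _.
apply: eqmod_trans (assoc_mulr t s u w) _; exact: ls.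
Qed.

Lemma passoc_mulr s t u w :
  eqQ (op m (passoc m << s >> << t >> << u >>) << w >>)
      (passoc m << s >> (op m << t >> << w >>) << u >>).
Proof.
apply: eqmod_trans _ (passoc_shift s t u w).
apply: (@eqmod_eq K Q V _ _ _ _ _ _ (assoc_mulr s t u w)).
  exact: (congr1 (fun p => op m p << w >>) (passocU s t u)).
exact: etrans (congr1 (fun p => passoc m p << t >> << u >>) (opU m s w))
  (passocU (Op m s w) t u).
Qed.

End Identities.

(** * The pentagon *)

Section Pentagon.
Variable K : fieldType.
Local Notation E := (regular K).
Local Notation pre V := {malg K[term (s2space E) V]}.
Variables (R : pre 'I_3 -> Prop) (hR : forall r, R r -> arity (enum 'I_3) r).
Let Q := Quadratic hR.
Local Notation eqQ := (@eqmod K Q _).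
Variable m : s2space E.
Hypothesis rc : forall s t u : term E 'I_5, eqQ << lassoc m s t u >> << lassoc m s u t >>.
Hypothesis ls : forall s t u : term E 'I_5, eqQ (assoc m s t u) (assoc m t s u).
Variable x : E -> K.
Variable psi : family Q 5.
Hypothesis psi2 : cochain 2 psi.
Hypothesis dpsi : eq_cochain (Q := Q) 3 (differential psi) (phi x).
Implicit Types (p q r : pre 'I_5).
Local Notation psi_value := (psi_value psi).

Local Notation v i := (xvar E (i : 'I_5)).

Lemma plug_op c p a b : plug c p (op m a b) = op m (plug c p a) (plug c p b).
Proof. exact: subst_op. Qed.

Lemma plug_passoc c p a b r : plug c p (passoc m a b r) =
  passoc m (plug c p a) (plug c p b) (plug c p r).
Proof.
apply: etrans (substB _ _ _) _; apply: (congr2 (fun a b => a - b)).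
  exact: etrans (subst_op _ _ _ _) (congr1 (op m _) (subst_op _ _ _ _)).
exact: etrans (subst_op _ _ _ _) (congr1 (opl m _) (subst_op _ _ _ _)).
Qed.

Lemma plug_first c p i : minc c i -> plug c p (v i) = p.
Proof. by move=> ci; rewrite /plug substU /= ci. Qed.

Lemma plug_other c p i : ~~ minc c i -> plug c p (v i) = v i.
Proof. by move=> /negPf ci; rewrite /plug substU /= ci. Qed.

(* In a contraction one of the two remaining vertices is the parent and receives
   a composite; these lemmas select the branch without unfolding the composite. *)
Lemma if_yes (A : Type) (b : bool) (p q r : A) : b -> p = r -> (if b then p else q) = r.
Proof. by move=> ->. Qed.

Lemma if_no (A : Type) (b : bool) (p q : A) : ~~ b -> (if b then p else q) = q.
Proof. by move/negPf=> ->. Qed.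

Lemma Phi_deco2 y z p q r rz qz ry qy A B C : treec [:: y; z] ->
  [&& perm_eq A (inputc [:: top; y; z] top), perm_eq B (inputc [:: top; y; z] y)
    & perm_eq C (inputc [:: top; y; z] z)] ->
  arity A r -> arity B p -> arity C q ->
  (if parentc [:: top; y; z] y top then plug y p r else r) = rz ->
  (if parentc [:: top; y; z] y z then plug y p q else q) = qz ->
  (if parentc [:: top; y; z] z top then plug z q r else r) = ry ->
  (if parentc [:: top; y; z] z y then plug z q p else p) = qy ->
  decorates1 z rz qz -> decorates1 y ry qy ->
  Phi x y z (deco2 y p z q r) = psi_value z rz qz - psi_value y ry qy.
Proof.
move=> tl /and3P [pA pB pC] rA pB' qC erz eqz ery eqy dz dy.
have [yc zc] : y \in codes /\ z \in codes.
  by have /andP [/mem_subseq h _] := tl; rewrite !h ?inE ?eqxx ?orbT.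
have yz : (set_of z == set_of y) = false.
  have := codes_uniq; have /andP [/subseq_uniq h _] := tl; move/h => /=.
  rewrite inE andbT => nyz; apply/negP => /eqP e; case/eqP: nyz.
  by apply/esym; apply: set_of_inj e; rewrite in_cons ?yc ?zc orbT.
have dyE : deco2 y p z q r (set_of y) = p by rewrite /deco2 eqxx.
have dzE : deco2 y p z q r (set_of z) = q by rewrite /deco2 yz eqxx.
have dtE : deco2 y p z q r (set_of top) = r by rewrite /deco2 !set_of_top_neq.
have cU : all uniq (top :: codes) by vm_compute.
apply: (@Phi_coboundary K R hR psi x dpsi) => //.
- apply: decorates_tree_set => e; rewrite !in_cons orbF.
  case/or3P => /eqP ->; split; rewrite ?dyE ?dzE ?dtE.
  + by vm_compute.
  + exact: arity_perm pA rA.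
  + by apply: (allP cU); rewrite in_cons yc orbT.
  + exact: arity_perm pB pB'.
  + by apply: (allP cU); rewrite in_cons zc orbT.
  exact: arity_perm pC qC.
- by apply: psi_contract; rewrite ?dyE ?dzE ?dtE.
apply: psi_contract; rewrite ?dyE ?dzE ?dtE //.
exact: (permEl (perm_catC [:: y] [:: z])).
Qed.

Lemma decorates1P e r q A B : arity A r -> arity B q ->
  perm_eq A (inputc [:: top; e] top) && perm_eq B (inputc [:: top; e] e) ->
  decorates1 e r q.
Proof. by move=> rA qB /andP [pA pB]; split; [apply: arity_perm rA | apply: arity_perm qB]. Qed.

Local Notation B i j := (op m (v i) (v j)).
Local Notation A3 p q r := (passoc m p q r).
Local Notation T := (A3 (v i0) (v i1) (v i2)).

Lemma arity_var i : arity [:: i] (v i).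
Proof. exact: arity_monomial. Qed.

Lemma arity_B i j : arity [:: i; j] (B i j).
Proof. exact: (@arity_op K E _ [:: i] [:: j] m (v i) (v j) (@arity_var i) (@arity_var j)). Qed.

Lemma arity_T : arity [:: i0; i1; i2] T.
Proof. exact: (arity_passoc (@arity_var i0) (@arity_var i1) (@arity_var i2)). Qed.

Lemma arity_T4 : arity [:: i0; i1; i2; i4] (op m T (v i4)).
Proof. exact: (arity_op (arity_T) (@arity_var i4)). Qed.

Lemma arity_T0 i : arity [:: i0; i; i1; i2] (A3 (B i0 i) (v i1) (v i2)).
Proof. exact: (arity_passoc (@arity_B i0 i) (@arity_var i1) (@arity_var i2)). Qed.

Lemma arity_T1 i : arity [:: i0; i1; i; i2] (A3 (v i0) (B i1 i) (v i2)).
Proof. exact: (arity_passoc (@arity_var i0) (@arity_B i1 i) (@arity_var i2)). Qed.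

Lemma arity_B2 i j k : arity [:: i; j; k] (op m (B i j) (v k)).
Proof. exact: (arity_op (@arity_B i j) (@arity_var k)). Qed.

Lemma plug_B_first c p i j : minc c i && ~~ minc c j -> plug c p (B i j) = op m p (v j).
Proof.
case/andP => ci cj; apply: etrans (plug_op _ _ _ _) _.
exact: (congr2 (op m) (plug_first p ci) (plug_other p cj)).
Qed.

Lemma plug_T0 c p : [&& minc c i0, ~~ minc c i1 & ~~ minc c i2] ->
  plug c p T = A3 p (v i1) (v i2).
Proof.
case/and3P => c0 c1 c2; apply: etrans (plug_passoc _ _ _ _ _) _.
apply: etrans (congr1 (fun a => A3 a _ _) (plug_first p c0)) _.
exact: (congr2 (fun a b => A3 p a b) (plug_other p c1) (plug_other p c2)).
Qed.

Lemma plug_T1 c p : [&& ~~ minc c i0, minc c i1 & ~~ minc c i2] ->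
  plug c p T = A3 (v i0) p (v i2).
Proof.
case/and3P => c0 c1 c2; apply: etrans (plug_passoc _ _ _ _ _) _.
apply: etrans (congr1 (fun a => A3 a _ _) (plug_other p c0)) _.
exact: (congr2 (fun a b => A3 (v i0) a b) (plug_first p c1) (plug_other p c2)).
Qed.

Local Notation c03 := [:: i0; i3].
Local Notation c13 := [:: i1; i3].
Local Notation c14 := [:: i1; i4].
Local Notation c134 := [:: i1; i3; i4].
Local Notation c0123 := [:: i0; i1; i2; i3].

(* The sides of the pentagon: each of the five trees gives the difference of its
   two contractions. *)
Lemma Phi_03_14 : Phi x c03 c14 (deco2 c03 (B i0 i3) c14 (B i1 i4) T) =
  psi_value c14 (A3 (B i0 i3) (v i1) (v i2)) (B i1 i4)
  - psi_value c03 (A3 (v i0) (B i1 i4) (v i2)) (B i0 i3).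
Proof.
apply: (Phi_deco2 _ _ arity_T (@arity_B _ _) (@arity_B _ _)).
- by vm_compute.
- by vm_compute.
- by apply if_yes; [|apply: plug_T0]; vm_compute.
- by apply if_no; vm_compute.
- by apply if_yes; [|apply: plug_T1]; vm_compute.
- by apply if_no; vm_compute.
- by apply: (decorates1P (@arity_T0 _) (@arity_B _ _)); vm_compute.
by apply: (decorates1P (@arity_T1 _) (@arity_B _ _)); vm_compute.
Qed.

Lemma Phi_03_0123 : Phi x c03 c0123 (deco2 c03 (B i0 i3) c0123 T (B i0 i4)) =
  psi_value c0123 (B i0 i4) (A3 (B i0 i3) (v i1) (v i2))
  - psi_value c03 (op m T (v i4)) (B i0 i3).
Proof.
apply: (Phi_deco2 _ _ (@arity_B _ _) (@arity_B _ _) arity_T).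
- by vm_compute.
- by vm_compute.
- by apply if_no; vm_compute.
- by apply if_yes; [|apply: plug_T0]; vm_compute.
- by apply if_yes; [|apply: plug_B_first]; vm_compute.
- by apply if_no; vm_compute.
- by apply: (decorates1P (@arity_B _ _) (@arity_T0 _)); vm_compute.
by apply: (decorates1P arity_T4 (@arity_B _ _)); vm_compute.
Qed.

Lemma Phi_13_134 : Phi x c13 c134 (deco2 c13 (B i1 i3) c134 (B i1 i4) T) =
  psi_value c134 T (op m (B i1 i3) (v i4))
  - psi_value c13 (A3 (v i0) (B i1 i4) (v i2)) (B i1 i3).
Proof.
apply: (Phi_deco2 _ _ arity_T (@arity_B _ _) (@arity_B _ _)).
- by vm_compute.
- by vm_compute.
- by apply if_no; vm_compute.
- by apply if_yes; [|apply: plug_B_first]; vm_compute.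
- by apply if_yes; [|apply: plug_T1]; vm_compute.
- by apply if_no; vm_compute.
- by apply: (decorates1P arity_T (@arity_B2 _ _ _)); vm_compute.
by apply: (decorates1P (@arity_T1 _) (@arity_B _ _)); vm_compute.
Qed.

Lemma Phi_13_0123 : Phi x c13 c0123 (deco2 c13 (B i1 i3) c0123 T (B i0 i4)) =
  psi_value c0123 (B i0 i4) (A3 (v i0) (B i1 i3) (v i2))
  - psi_value c13 (op m T (v i4)) (B i1 i3).
Proof.
apply: (Phi_deco2 _ _ (@arity_B _ _) (@arity_B _ _) arity_T).
- by vm_compute.
- by vm_compute.
- by apply if_no; vm_compute.
- by apply if_yes; [|apply: plug_T1]; vm_compute.
- by apply if_yes; [|apply: plug_B_first]; vm_compute.
- by apply if_no; vm_compute.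
- by apply: (decorates1P (@arity_B _ _) (@arity_T1 _)); vm_compute.
by apply: (decorates1P arity_T4 (@arity_B _ _)); vm_compute.
Qed.

Lemma Phi_14_134 : Phi x c14 c134 (deco2 c14 (B i1 i4) c134 (B i1 i3) T) =
  psi_value c134 T (op m (B i1 i4) (v i3))
  - psi_value c14 (A3 (v i0) (B i1 i3) (v i2)) (B i1 i4).
Proof.
apply: (Phi_deco2 _ _ arity_T (@arity_B _ _) (@arity_B _ _)).
- by vm_compute.
- by vm_compute.
- by apply if_no; vm_compute.
- by apply if_yes; [|apply: plug_B_first]; vm_compute.
- by apply if_yes; [|apply: plug_T1]; vm_compute.
- by apply if_no; vm_compute.
- by apply: (decorates1P arity_T (@arity_B2 _ _ _)); vm_compute.
by apply: (decorates1P (@arity_T1 _) (@arity_B _ _)); vm_compute.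
Qed.

(* The corners of the pentagon: the two contractions that meet at a tree with two
   vertices are congruent there, by right-commutativity at 134 and by the shift of
   right multiplications through the associator at the others. *)
Lemma cycle_14 :
  psi_value c14 (A3 (B i0 i3) (v i1) (v i2)) (B i1 i4) =
  psi_value c14 (A3 (v i0) (B i1 i3) (v i2)) (B i1 i4).
Proof.
apply: (psi_value_root psi2); first by vm_compute.
- by apply: (decorates1P (@arity_T0 _) (@arity_B _ _)); vm_compute.
- by apply: (decorates1P (@arity_T1 _) (@arity_B _ _)); vm_compute.
exact: (@passoc_shift K R hR _ m rc ls).
Qed.

Lemma cycle_03 :
  psi_value c03 (op m T (v i4)) (B i0 i3) =
  psi_value c03 (A3 (v i0) (B i1 i4) (v i2)) (B i0 i3).
Proof.
apply: (psi_value_root psi2); first by vm_compute.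
- by apply: (decorates1P arity_T4 (@arity_B _ _)); vm_compute.
- by apply: (decorates1P (@arity_T1 _) (@arity_B _ _)); vm_compute.
exact: (@passoc_mulr K R hR _ m rc ls).
Qed.

Lemma cycle_13 :
  psi_value c13 (op m T (v i4)) (B i1 i3) =
  psi_value c13 (A3 (v i0) (B i1 i4) (v i2)) (B i1 i3).
Proof.
apply: (psi_value_root psi2); first by vm_compute.
- by apply: (decorates1P arity_T4 (@arity_B _ _)); vm_compute.
- by apply: (decorates1P (@arity_T1 _) (@arity_B _ _)); vm_compute.
exact: (@passoc_mulr K R hR _ m rc ls).
Qed.

Lemma cycle_0123 :
  psi_value c0123 (B i0 i4) (A3 (B i0 i3) (v i1) (v i2)) =
  psi_value c0123 (B i0 i4) (A3 (v i0) (B i1 i3) (v i2)).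
Proof.
apply: (psi_value_edge psi2); first by vm_compute.
- by apply: (decorates1P (@arity_B _ _) (@arity_T0 _)); vm_compute.
- by apply: (decorates1P (@arity_B _ _) (@arity_T1 _)); vm_compute.
exact: (@passoc_shift K R hR _ m rc ls).
Qed.

Lemma cycle_134 :
  psi_value c134 T (op m (B i1 i3) (v i4)) =
  psi_value c134 T (op m (B i1 i4) (v i3)).
Proof.
apply: (psi_value_edge psi2); first by vm_compute.
- by apply: (decorates1P arity_T (@arity_B2 _ _ _)); vm_compute.
- by apply: (decorates1P arity_T (@arity_B2 _ _ _)); vm_compute.
exact: (@eqmod_rc K R hR _ m rc).
Qed.

End Pentagon.

(** * The Novikov operads are not Koszul *)

Section Values.
Variables (K : fieldType) (x : regular K -> K) (m : s2space (regular K)).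
Local Notation E := (regular K).
Hypotheses (xm : x m = 1) (xfm : x (flip m) = 0).
Local Notation ev := (@ev K 5 x).
Local Notation gen1 := (@gen1 K 5).
Local Notation dot := (@dot K 5).

Lemma act_dot u v : act x dot m u v = dot u v.
Proof. by rewrite /act xm xfm scale1r scale0r addr0. Qed.

Lemma ev_product i j k l :
  ev (op m (xvar E i) (xvar E j)) (W2 k l) = ((i == k) && (j == l))%:R.
Proof.
rewrite /ev; apply: etrans (congr1 (fun p => eval x dot gen1 p (W2 k l)) (opU m (Var i) (Var j))) _.
by rewrite evalU term_eval2_W2 xm xfm mul1r mul0r addr0.
Qed.

(** The associator is x_0 x_1 x_2'': in x_0 (x_1 x_2')' - (x_0 x_1') x_2' the terms
x_0 x_1' x_2' cancel. *)
Lemma ev_associator : ev (passoc m (xvar E i0) (xvar E i1) (xvar E i2)) (W3'' i0 i1 i2) = 1.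
Proof.
rewrite /ev.
apply: etrans (congr1 (fun p => eval x dot gen1 p (W3'' i0 i1 i2))
  (passocU m (Var i0) (Var i1) (Var i2))) _.
rewrite evalB {1}evalU {1}evalU /= !act_dot !ffunE /= !ffunE /= !ffunE /=.
ring_in K.
Qed.

Lemma Phi_empty y z d : rows_at y z = [::] -> Phi x y z d = 0.
Proof. by move=> e; rewrite /Phi e big_nil. Qed.

Lemma Phi_13_0123E p q r :
  Phi x [:: i1; i3] [:: i0; i1; i2; i3] (deco2 [:: i1; i3] p [:: i0; i1; i2; i3] q r) =
  (ev r (W2 i0 i4) - ev r (W2 i4 i0)) * ev p (W2 i1 i3) * ev q (W3'' i0 i1 i2).
Proof.
have e : rows_at [:: i1; i3] [:: i0; i1; i2; i3] =
    expand_row false [:: i1; i3] [:: i0; i1; i2; i3] (comm i0 i4) (bin i1 i3)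
      (pure (W3'' i0 i1 i2)) by vm_compute.
rewrite /Phi e !big_cons big_nil /row_value !big_cons !big_nil.
rewrite /deco2 !set_of_top_neq //.
have -> : (set_of [:: i0; i1; i2; i3] == set_of [:: i1; i3]) = false.
  by apply/negP => /eqP /set_of_inj h; have := h isT isT.
rewrite !eqxx /mono_at /=; ring.
Qed.

End Values.

Section NotExact.
Variable K : fieldType.
Local Notation E := (regular K).
Local Notation pre V := {malg K[term (s2space E) V]}.
Variables (R : pre 'I_3 -> Prop) (hR : forall r, R r -> arity (enum 'I_3) r).
Let Q := Quadratic hR.
Local Notation eqQ := (@eqmod K Q _).
Variable m : s2space E.
Hypothesis rc : forall s t u : term E 'I_5, eqQ << lassoc m s t u >> << lassoc m s u t >>.
Hypothesis ls : forall s t u : term E 'I_5, eqQ (assoc m s t u) (assoc m t s u).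
Variable x : E -> K.
Hypothesis xP : forall a e f, x (a *: e + f) = a * x e + x f.
Hypothesis xR : forall r w, R r -> eval x (@dot K 5) w r = 0.
Hypotheses (xm : x m = 1) (xfm : x (flip m) = 0).

Lemma Phi_13_0123_value :
  Phi x [:: i1; i3] [:: i0; i1; i2; i3] (deco2 [:: i1; i3] (op m (xvar E i1) (xvar E i3))
    [:: i0; i1; i2; i3] (passoc m (xvar E i0) (xvar E i1) (xvar E i2)) (op m (xvar E i0) (xvar E i4))) = 1.
Proof.
apply: etrans (Phi_13_0123E _ _ _ _) _.
apply: etrans (congr2 *%R (congr2 *%R (congr2 (fun a b => a - b)
  (ev_product xm xfm i0 i4 i0 i4) (ev_product xm xfm i0 i4 i4 i0))
  (ev_product xm xfm i1 i3 i1 i3)) (ev_associator xm xfm)) _.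
by rewrite /= subr0 !mulr1.
Qed.

(** If phi were the coboundary of psi, going around the pentagon would identify the
two values of psi whose difference is the value 1 of phi at {13, 0123}. *)
Theorem not_exact_5_3 : ~ exact_at Q 5 3.
Proof.
move=> exact53; have [psi psi2 dpsi] := exact53 _ (@cochain_phi K R hR x xP xR)
  (@cocycle_phi K R hR x).
have closed a b y z d : Phi x y z d = a - b -> rows_at y z = [::] -> a = b.
  by move=> e /(Phi_empty x d) e0; apply: subr0_eq; rewrite -e.
have c1 := closed _ _ _ _ _ (Phi_03_14 m psi2 dpsi) ltac:(by vm_compute).
have c2 := closed _ _ _ _ _ (Phi_03_0123 m psi2 dpsi) ltac:(by vm_compute).
have c3 := closed _ _ _ _ _ (Phi_13_134 m psi2 dpsi) ltac:(by vm_compute).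
have c4 := closed _ _ _ _ _ (Phi_14_134 m psi2 dpsi) ltac:(by vm_compute).
have around : _ = _ := etrans (esym (cycle_0123 rc ls psi2)) (etrans c2
  (etrans (cycle_03 rc ls psi2) (etrans (esym c1) (etrans (cycle_14 rc ls psi2)
  (etrans (esym c4) (etrans (esym (cycle_134 rc psi2)) (etrans c3
  (esym (cycle_13 rc ls psi2))))))))).
have := etrans (etrans (esym Phi_13_0123_value) (Phi_13_0123 m psi2 dpsi))
  (etrans (congr1 (fun a => a - _) around) (subrr _)).
by move/eqP; rewrite oner_eq0.
Qed.

End NotExact.

Section Novikov.
Variable K : fieldType.
Local Notation E := (regular K).
Local Notation m := (mu K : s2space E).

Theorem left_novikov_not_koszul : ~ koszul (left_novikov K).
Proof.
move/(_ 5 3 isT); apply: (@not_exact_5_3 K _ (@left_novikov_arity K) m _ _ (fun e => e.1)).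
- exact: left_novikov_rc.
- exact: left_novikov_ls.
- by [].
- by move=> r w; apply: eval_left_relators.
- by [].
by [].
Qed.

(* In a right-Novikov algebra the opposite product is right-commutative and
   left-symmetric, so the argument applies to [flip mu]. *)
Section Opposite.
Variable V : choiceType.
Local Notation eqR := (@eqmod K (right_novikov K) V).
Implicit Types s t u : term E V.

Lemma monomial_flip s t : eqR << Op (flip m) s t >> << Op m t s >>.
Proof. by have := ideal_flip (flip m : gen (right_novikov K)) s t; rewrite flipK. Qed.

Lemma lassoc_flip s t u : eqR << lassoc (flip m) s t u >> << rassoc m u t s >>.
Proof.
apply: eqmod_trans (monomial_flip (Op (flip m) s t) u) _.
have h := @eqmod_op K (right_novikov K) V m _ _ _ _
  (@eqmod_refl K (right_novikov K) V << u >>) (monomial_flip s t).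
exact: (@eqmod_eq K (right_novikov K) V _ _ _ _ (esym (opU _ _ _)) (esym (opU _ _ _)) h).
Qed.

Lemma rassoc_flip s t u : eqR << rassoc (flip m) s t u >> << lassoc m u t s >>.
Proof.
apply: eqmod_trans (monomial_flip s (Op (flip m) t u)) _.
have h := @eqmod_op K (right_novikov K) V m _ _ _ _
  (monomial_flip t u) (@eqmod_refl K (right_novikov K) V << s >>).
exact: (@eqmod_eq K (right_novikov K) V _ _ _ _ (esym (opU _ _ _)) (esym (opU _ _ _)) h).
Qed.

Lemma assoc_flip s t u : eqR (assoc (flip m) s t u) (- assoc m u t s).
Proof.
rewrite /assoc opprB; exact: eqmodB (rassoc_flip s t u) (lassoc_flip s t u).
Qed.

Lemma right_novikov_rc s t u :
  eqR << lassoc (flip m) s t u >> << lassoc (flip m) s u t >>.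
Proof.
apply: eqmod_trans (lassoc_flip s t u) _.
exact: eqmod_trans (right_novikov_lc u t s) (eqmod_sym (lassoc_flip s u t)).
Qed.

Lemma right_novikov_ls s t u : eqR (assoc (flip m) s t u) (assoc (flip m) t s u).
Proof.
apply: eqmod_trans (assoc_flip s t u) _.
exact: eqmod_trans (eqmodN (right_novikov_rs u t s)) (eqmod_sym (assoc_flip t s u)).
Qed.

End Opposite.

Theorem right_novikov_not_koszul : ~ koszul (right_novikov K).
Proof.
move/(_ 5 3 isT).
apply: (@not_exact_5_3 K _ (@right_novikov_arity K) (flip m) _ _ (fun e => e.2)).
- exact: right_novikov_rc.
- exact: right_novikov_ls.
- by [].
- by move=> r w; apply: eval_right_relators.
- by [].
by [].
Qed.

End Novikov.

Theorem theorem1p3 (K : fieldType) :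
  [/\ isomorphic_along (P := quadratic_dual (left_novikov K))
        (Q := right_novikov K) (mu_dual K) (mu K),
      isomorphic_along (P := quadratic_dual (right_novikov K))
        (Q := left_novikov K) (mu_dual K) (mu K),
      ~ koszul (left_novikov K)
    & ~ koszul (right_novikov K)].
Proof.
split; [exact: dual_left_novikov | exact: dual_right_novikov
  | exact: left_novikov_not_koszul | exact: right_novikov_not_koszul].
Qed.
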